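(* Let $q$ be a Pisot or Salem number. Let $\ell \ge 1$ be an integer and let $f_j(x)$ $(j=1,2,\dots,\ell)$ be integer-valued polynomials of degree $\ge 2$ with positive leading coefficients. Let $\{a_j(n)\}_{n\ge1}$ $(j=1,2,\dots,\ell)$ be sequences of algebraic integers in the field $\mathbb{Q}(q)$ such that $\log(1+|\sigma(a_j(n))|)=o(n)$ as $n\to\infty$ for every field embedding $\sigma\colon \mathbb{Q}(q)\to\mathbb{C}$ and every $j$. Suppose that for every non-empty subset $\mathcal{S}$ of $\{1,2,\dots,\ell\}$ there exist integers $i\in\mathcal{S}$ and $A$ satisfying the following two conditions: (i) $f_i(x+A)\not\equiv f_j(Bx+C)+D$ for all integers $j\in\mathcal{S}\setminus\{i\}$, all integers $C$, $D$ and all positive rational numbers $B$; (ii) there exists a positive integer $E$ such that $\liminf_{n\to\infty}|a_i(En+A)|\neq 0$. Then the numbers $$1,\qquad \sum_{n=1}^{\infty}\frac{a_j(n)}{q^{f_j(n)}}\quad (j=1,2,\dots,\ell)$$ are linearly independent over $\mathbb{Q}(q)$.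
   Context: A Pisot number (resp. Salem number) is a real algebraic integer greater than $1$ all of whose Galois conjugates other than itself have absolute value less than $1$ (resp. less than or equal to $1$, with at least one conjugate of absolute value exactly $1$). A polynomial $f(x)$ is integer-valued if $f(n)\in\mathbb{Z}$ for every positive integer $n$. For polynomials $F,G$, the notation $F(x)\equiv G(x)$ means that they are identically equal as polynomials, and $F(x)\not\equiv G(x)$ means they are not. *)

(* Defs.v *)
From HB Require Import structures.
From mathcomp Require Import all_boot all_order all_algebra.
From mathcomp Require Import all_classical all_reals all_analysis.
From mathcomp Require Import complex.

Set Implicit Arguments.
Unset Strict Implicit.
Unset Printing Implicit Defensive.

Import Order.TTheory GRing.Theory Num.Theory.
Import numFieldNormedType.Exports.

Local Open Scope ring_scope.
Local Open Scope complex_scope.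

Section NumberField.
Variables (R : realType) (q : R).

(* Q(q) inside R; Qadj below is the corresponding field type, included by val. *)
Definition Qadj_pred : {pred R} := fun x =>
  `[< exists p r : {poly rat},
        (map_poly ratr r).[q] != 0 /\
        x = (map_poly ratr p).[q] / (map_poly ratr r).[q] >].

Lemma Qadj_divring_closed : divring_closed Qadj_pred.
Proof.
split.
- by apply/asboolP; exists 1, 1; rewrite rmorph1 hornerE oner_eq0 divr1.
- move=> x y /asboolP[p [r [r0 ->]]] /asboolP[p' [r' [r'0 ->]]].
  apply/asboolP; exists (p * r' - p' * r), (r * r').
  rewrite rmorphB !rmorphM /= !hornerE mulf_neq0 //; split=> //.
  by rewrite -mulNr addf_div // mulNr.
- move=> x y /asboolP[p [r [r0 ->]]] /asboolP[p' [r' [r'0 ->]]].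
  apply/asboolP.
  have [p'0|p'0] := eqVneq (map_poly ratr p').[q] 0.
    exists 0, 1; rewrite rmorph0 rmorph1 !hornerE oner_eq0; split=> //.
    by rewrite p'0 !mul0r invr0 mulr0.
  exists (p * r'), (r * p'); rewrite !rmorphM /= !hornerE mulf_neq0 //.
  by split=> //; rewrite invf_div mulf_div.
Qed.

HB.instance Definition _ :=
  GRing.isDivringClosed.Build R Qadj_pred Qadj_divring_closed.

Record Qadj := InQadj { Qadj_val : R; Qadj_valP : Qadj_val \in Qadj_pred }.

HB.instance Definition _ := [isSub for Qadj_val].
HB.instance Definition _ := [Choice of Qadj by <:].
HB.instance Definition _ := [SubChoice_isSubIntegralDomain of Qadj by <:].
HB.instance Definition _ := [SubIntegralDomain_isSubField of Qadj by <:].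

End NumberField.

Definition algebraic_integer (R : realType) (x : R) : Prop :=
  integralOver (intr : int -> R) x.

(* z is a root of the minimal polynomial of x over Q (hence x is algebraic). *)
Definition galois_conjugate (R : realType) (x : R) (z : R[i]) : Prop :=
  exists p : {poly rat},
    [/\ p \is monic, irreducible_poly p,
        root (map_poly ratr p) x & root (map_poly ratr p) z].

Definition pisot (R : realType) (q : R) : Prop :=
  [/\ algebraic_integer q, 1 < q &
      forall z : R[i], galois_conjugate q z -> z <> q%:C -> Normc.normc z < 1].

Definition salem (R : realType) (q : R) : Prop :=
  [/\ algebraic_integer q, 1 < q,
      forall z : R[i], galois_conjugate q z -> z <> q%:C -> Normc.normc z <= 1 &
      exists2 z : R[i], galois_conjugate q z & Normc.normc z = 1].

Definition integer_valued (R : realType) (f : {poly R}) : Prop :=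
  forall n : nat, (0 < n)%N -> exists m : int, f.[n%:R] = m%:~R.

Definition linearly_independent_over (K F : fieldType) (iota : {rmorphism K -> F})
    (I : finType) (x : I -> F) : Prop :=
  forall c : I -> K, \sum_i iota (c i) * x i = 0 -> forall i, c i = 0.

(* Main.v *)
Require Import Defs.
From HB Require Import structures.
From mathcomp Require Import all_boot all_order all_algebra all_field.
From mathcomp Require Import all_classical all_reals all_analysis.
From mathcomp Require Import complex polyorder polyrcf zify ring lra.

(** Let [c0 + sum_j c_j x_j = 0] with algebraic integer coefficients, [S] the set
    of [j] with [c_j <> 0], and [M] an integer such that no exponent [f_j(n)] with
    [j] in [S] lies in a gap [(M, M + g)]. Multiplying by [q^M] and keeping the
    terms with [f_j(n) <= M] gives an algebraic integer of Q(q), whose absolute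
    value is at most [q^-g] up to a subexponential factor, while its other
    conjugates are subexponential because those of [q] lie in the closed unit
    disc. If [g] is at least a fixed multiple of the largest index occurring, the
    norm is less than 1 and the truncated sum vanishes. If [f_i(N)] is isolated
    between two such gaps, subtracting two consecutive truncated sums yields
    [c_i a_i(N) = 0].

    It remains to isolate [f_i(N)] for infinitely many [N = A mod E]. The
    hypothesis is applied to the elements of [S] of least degree [d], so that a
    gap of order [N] suffices. Polynomials of higher degree are too sparse to
    interfere. For [f_j] of degree [d], [f_j(n)] close to [f_i(N)] forces [n] to be
    close to [al N + be], where [f_i(x) - f_j(al x + be)] has degree at most
    [d - 2]. If [al] is irrational this happens at most once in a short window
    of [N]; if [al] is rational and [N = A] modulo its denominator, then
    [al N + be] has a constant fractional part, and condition (i) prevents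
    [f_i(x + A) - f_j(al x + C)] from being constant. *)

Set Implicit Arguments.
Unset Strict Implicit.
Unset Printing Implicit Defensive.

Import Order.TTheory GRing.Theory Num.Theory.
Import numFieldNormedType.Exports.

Local Open Scope classical_set_scope.
Local Open Scope ring_scope.

(** * The number field Q(q) and its embeddings *)

(** Being a root of a given integer polynomial is a statement over the rationals, so it carries over
    from [F] to [algC], where a rational algebraic integer is known to be an integer. *)
Lemma integral_rat_int (F : numFieldType) (r : rat) :
  integralOver (intr : int -> F) (ratr r) -> r \is a Num.int.
Proof.
move=> [p pm pr].
have : ratr r \in Aint.
  apply: (@root_monic_Aint (map_poly intr p)); last 2 first.
  - by rewrite monic_map.
  - by apply/polyOverP => i; rewrite coef_map /= rpred_int.
  have E (K : numFieldType) (s : {poly int}) :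
      map_poly (intr : int -> K) s = map_poly ratr (map_poly (intr : int -> rat) s).
    by rewrite -map_poly_comp; apply: eq_map_poly => i /=; rewrite ratr_int.
  by move: pr; rewrite (E F) (E algC) !fmorph_root.
move=> /(Cint_rat_Aint (Crat_rat r))/intrP[n Hn].
apply/intrP; exists n; apply: (fmorph_inj (ratr : {rmorphism rat -> algC})).
by rewrite /= Hn ratr_int.
Qed.

(* The matrix of multiplication by [g] modulo [m] in the basis 1, X, ... is
   diagonalised by the Vandermonde matrix of the roots of [m]. *)
Lemma prod_horner_roots_rat (F : numFieldType) (m g : {poly rat}) (rs : seq F) :
  map_poly ratr m = \prod_(z <- rs) ('X - z%:P) -> uniq rs ->
  exists r : rat, \prod_(z <- rs) (map_poly ratr g).[z] = ratr r.
Proof.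
move=> mE urs; set n := size rs.
have sm : size m = n.+1.
  by rewrite -(size_map_poly (ratr : {rmorphism rat -> F})) /= mE size_prod_XsubC.
have m0 : m != 0 by rewrite -size_poly_gt0 sm.
pose A : 'M[rat]_n := \matrix_(i, j) (('X^i * g) %% m)`_j.
pose z : 'rV[F]_n := \row_(i < n) rs`_i.
pose D : 'rV[F]_n := \row_(i < n) (map_poly ratr g).[rs`_i].
have AV : map_mx ratr A *m Vandermonde n z = Vandermonde n z *m diag_mx D.
  apply/matrixP => i k; rewrite mul_mx_diag !mxE.
  transitivity (map_poly ratr (('X^i * g) %% m)).[rs`_k].
    rewrite (@horner_coef_wide _ n).
      by apply: eq_bigr => j _; rewrite !mxE coef_map.
    by rewrite size_map_poly -ltnS -sm ltn_modp.
  have mk : (map_poly ratr m).[rs`_k] = 0.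
    by apply/eqP; rewrite -/(root _ _) mE root_prod_XsubC mem_nth.
  have := congr1 (fun p => (map_poly ratr p).[rs`_k]) (divp_eq ('X^i * g) m).
  by rewrite rmorphD !rmorphM /= !hornerE mk mulr0 add0r map_polyXn !hornerE => ->.
have V0 : \det (Vandermonde n z) != 0.
  rewrite det_Vandermonde; apply/prodf_neq0 => i _; apply/prodf_neq0 => j ij.
  by rewrite !mxE subr_eq0 nth_uniq // neq_ltn ij orbT.
exists (\det A); move/(congr1 determinant): AV.
rewrite !det_mulmx mulrC => /(mulfI V0); rewrite det_map_mx => ->.
rewrite det_diag (big_nth 0) big_mkord; apply: eq_bigr => i _.
by rewrite mxE.
Qed.

Section Embeddings.
Variables (R : realType) (q : R).
Hypothesis qint : algebraic_integer q.
Import Normc.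

(** A nonzero rational polynomial of least size vanishing at [q] divides all others, since the
    remainder vanishes at [q] and is shorter. In a factorisation one factor vanishes at [q] and is
    therefore divisible by the whole polynomial. *)
Lemma minimal_polynomial_exists : exists m : {poly rat},
  [/\ m \is monic, irreducible_poly m &
      forall g : {poly rat}, root (map_poly ratr g) q = (m %| g)].
Proof.
have [p0 p0m p0q] := qint.
pose P n := `[< exists p : {poly rat}, [/\ size p = n, p != 0 & root (map_poly ratr p) q] >].
have exP : exists n, P n.
  exists (size (map_poly (intr : int -> rat) p0)); apply/asboolP.
  exists (map_poly intr p0); split => //.
    by rewrite monic_neq0 // monic_map.
  rewrite -map_poly_comp; move: p0q; congr (root _ _).
  by apply: eq_map_poly => i /=; rewrite ratr_int.
case: (ex_minnP exP) => n /asboolP[p [sp p0' pq]] minn.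
have dvd (g : {poly rat}) : root (map_poly ratr g) q = (p %| g).
  apply/idP/idP => [gq|/dvdpP[h ->]]; last by rewrite rmorphM rootM pq orbT.
  rewrite /dvdp; apply/negPn/negP => r0.
  have : P (size (g %% p)).
    apply/asboolP; exists (g %% p); split => //.
    have := congr1 (fun s => (map_poly ratr s).[q]) (divp_eq g p).
    rewrite rmorphD rmorphM /= !hornerE (rootP gq) (rootP pq) mulr0 add0r => e.
    by apply/rootP.
  by move/minn; rewrite leqNgt -sp ltn_modp p0'.
have lp : lead_coef p != 0 by rewrite lead_coef_eq0.
exists ((lead_coef p)^-1 *: p); split.
- by rewrite monicE lead_coefZ mulVf.
- split.
    rewrite size_scale ?invr_eq0 // ltnNge; apply/negP => /size1_polyC pc.
    move: pq p0'; rewrite pc map_polyC /= rootC fmorph_eq0 => /eqP ->.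
    by rewrite eqxx.
  move=> h h1; rewrite dvdpZr ?invr_eq0 // => hp.
  have /dvdpP[k pE] := hp.
  rewrite (eqp_trans _ (_ : p %= _)) //; last by rewrite eqp_sym eqp_scale ?invr_eq0.
  move: pq; rewrite pE rmorphM rootM => /orP[]; rewrite dvd.
    move=> pk; have k0 : k != 0 by apply: contra_neq p0'; rewrite pE => ->; rewrite mul0r.
    have h0 : h != 0 by apply: contra_neq p0'; rewrite pE => ->; rewrite mulr0.
    have := dvdp_leq k0 pk; rewrite {1}pE size_mul //.
    by move: h1 h0; rewrite -size_poly_gt0; case: (size h) => [|[|s]] //; lia.
  by move=> ph; rewrite -pE /eqp hp ph.
- by move=> g; rewrite dvd dvdpZl ?invr_eq0.
Qed.

Definition minimal_polynomial : {poly rat} :=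
  projT1 (cid minimal_polynomial_exists).

Local Notation m := minimal_polynomial.

Lemma minimal_polynomialP :
  [/\ m \is monic, irreducible_poly m &
      forall g : {poly rat}, root (map_poly ratr g) q = (m %| g)].
Proof. exact: (projT2 (cid minimal_polynomial_exists)). Qed.

(** The denominator is coprime to the minimal polynomial; a Bezout relation evaluated at [q] inverts
    it by a polynomial. *)
Lemma Qadj_polynomial (x : Qadj q) :
  exists g : {poly rat}, val x = (map_poly ratr g).[q].
Proof.
have [_ irr mdvd] := minimal_polynomialP.
have /asboolP[p [r [r0 ->]]] := valP x.
have : coprimep m r by rewrite irreducible_poly_coprime // -mdvd.
move=> /Bezout_eq1_coprimepP[[u v] /= uv]; exists (p * v).
have := congr1 (fun s => (map_poly ratr s).[q]) uv.
have mq : (map_poly ratr m).[q] = 0 by apply/eqP; rewrite -/(root _ _) mdvd dvdpp.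
rewrite rmorphD !rmorphM rmorph1 /= !hornerE mq mulr0 add0r => vr.
by rewrite -[RHS]mulr1 -{1}(mulfV r0) mulrA -(mulrA _ (map_poly _ v).[q]) vr mulr1.
Qed.

Definition Qadj_rep (x : Qadj q) : {poly rat} := projT1 (cid (Qadj_polynomial x)).

Lemma Qadj_repP (x : Qadj q) : val x = (map_poly ratr (Qadj_rep x)).[q].
Proof. exact: (projT2 (cid (Qadj_polynomial x))). Qed.

Lemma conjugate_horner_eq (z : R[i]) (g h : {poly rat}) :
  root (map_poly ratr m) z -> (map_poly ratr g).[q] = (map_poly ratr h).[q] ->
  (map_poly ratr g).[z] = (map_poly ratr h).[z].
Proof.
have [_ _ mdvd] := minimal_polynomialP.
move=> mz gh; have : root (map_poly ratr (g - h)) q.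
  by rewrite rmorphB; apply/rootP; rewrite !hornerE gh subrr.
rewrite mdvd => /dvdpP[k e].
apply/eqP; rewrite -subr_eq0 -hornerN -hornerD -rmorphB /= e rmorphM hornerM /=.
by rewrite (rootP mz) mulr0.
Qed.

(** For arbitrary [z] the value depends on the chosen representative; at a root of the minimal
    polynomial all representatives agree. *)
Definition embedding_fun (z : R[i]) (x : Qadj q) : R[i] :=
  (map_poly ratr (Qadj_rep x)).[z].

Lemma embedding_exists (z : R[i]) : root (map_poly ratr m) z ->
  exists s : {rmorphism Qadj q -> R[i]}, forall (x : Qadj q) (g : {poly rat}),
    val x = (map_poly ratr g).[q] -> s x = (map_poly ratr g).[z].
Proof.
move=> mz.
have FE (x : Qadj q) (g : {poly rat}) :
    val x = (map_poly ratr g).[q] -> embedding_fun z x = (map_poly ratr g).[z].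
  by move=> xg; apply: conjugate_horner_eq => //; rewrite -Qadj_repP.
have fB : zmod_morphism (embedding_fun z).
  move=> x y; rewrite (FE _ (Qadj_rep x - Qadj_rep y)).
    by rewrite rmorphB hornerD hornerN.
  by rewrite [map_poly _ _]rmorphB hornerD hornerN -!Qadj_repP.
have fM : monoid_morphism (embedding_fun z).
  split; first by rewrite (FE _ 1) ?rmorph1 /= !hornerE.
  move=> x y; rewrite (FE _ (Qadj_rep x * Qadj_rep y)).
    by rewrite rmorphM hornerM.
  by rewrite [map_poly _ _]rmorphM hornerM -!Qadj_repP.
pose aM := GRing.isZmodMorphism.Build _ _ (embedding_fun z) fB.
pose mM := GRing.isMonoidMorphism.Build _ _ (embedding_fun z) fM.
pose s : {rmorphism Qadj q -> R[i]} := HB.pack (embedding_fun z) aM mM.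
by exists s.
Qed.


Lemma algebraic_integer_rmorph (s : {rmorphism Qadj q -> R[i]}) (x : Qadj q) :
  algebraic_integer (val x) -> integralOver (intr : int -> R[i]) (s x).
Proof.
move=> [p pm px]; exists p => //.
have vE : map_poly (intr : int -> R) p
    = map_poly (val : {rmorphism Qadj q -> R}) (map_poly intr p).
  rewrite -map_poly_comp; apply: eq_map_poly => i.
  exact/esym/(rmorph_int (val : {rmorphism Qadj q -> R})).
have sE : map_poly (intr : int -> R[i]) p = map_poly s (map_poly intr p).
  by rewrite -map_poly_comp; apply: eq_map_poly => i; rewrite /= rmorph_int.
by rewrite sE fmorph_root; rewrite vE fmorph_root in px.
Qed.

Lemma Qadj_gen_subproof : q \in Qadj_pred q.
Proof.
apply/asboolP; exists 'X, 1.
by rewrite rmorph1 map_polyX !hornerE oner_eq0 divr1.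
Qed.

Definition Qadj_gen : Qadj q := InQadj Qadj_gen_subproof.

Lemma normc_prod (I : Type) (r : seq I) (F : I -> R[i]) :
  normc (\prod_(k <- r) F k) = \prod_(k <- r) normc (F k).
Proof. by apply: big_morph; [exact: normcM|exact: normc1]. Qed.

Lemma normc_real (x : R) : normc x%:C%C = `|x|.
Proof. by rewrite /normc /= expr0n /= addr0 sqrtr_sqr. Qed.

(** The product of the images of [x] under all embeddings is its norm: rational and an algebraic
    integer, hence an integer, and of absolute value below 1, hence 0. Embeddings are injective, so
    [x = 0]. The family [s] omits the inclusion into the reals, which contributes the separate
    factor [val x]. *)
Lemma small_algebraic_integer_eq0 :
  (forall z : R[i], galois_conjugate q z -> z <> q%:C%C -> normc z <= 1) ->
  exists (d : nat) (s : 'I_d -> {rmorphism Qadj q -> R[i]}),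
    (forall k, normc (s k Qadj_gen) <= 1) /\
    forall x : Qadj q, algebraic_integer (val x) ->
      `|val x| * \prod_k normc (s k x) < 1 -> x = 0.
Proof.
move=> hconj; have [mm mirr mdvd] := minimal_polynomialP.
pose mC : {poly R[i]} := map_poly ratr m.
have [rs] := closed_field_poly_normal mC.
have -> : lead_coef mC = 1 by apply/eqP; rewrite -monicE map_monic.
rewrite scale1r => mE.
(* In characteristic 0 the derivative of [m] is nonzero and shorter than [m], hence not divisible by
   the irreducible [m]. *)
have sep : separable_poly m.
  rewrite unlock irreducible_poly_coprime //; apply/negP => dv.
  have m1 : (size m > 1)%N by case: mirr.
  have := dvdp_leq _ dv; rewrite -size_poly_eq0 size_deriv.
  by case: (size m) m1 => [|[|n]] //= _ /(_ isT); rewrite ltnn.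
have urs : uniq rs by rewrite -separable_prod_XsubC -mE separable_map.
have rsE (z : R[i]) : root mC z = (z \in rs) by rewrite mE root_prod_XsubC.
have qC (g : {poly rat}) :
    (map_poly (ratr : rat -> R[i]) g).[q%:C%C] = ((map_poly ratr g).[q])%:C%C.
  have -> : map_poly (ratr : rat -> R[i]) g
      = map_poly (real_complex R) (map_poly ratr g).
    by rewrite -map_poly_comp; apply: eq_map_poly => i /=; rewrite fmorph_rat.
  exact: horner_map.
have qrs : q%:C%C \in rs.
  rewrite -rsE; apply/rootP; rewrite qC.
  by have /rootP-> : root (map_poly ratr m) q by rewrite mdvd dvdpp.
pose rs' := rem q%:C%C rs; pose d := size rs'.
have rs'P (k : 'I_d) : rs'`_k \in rs /\ rs'`_k != q%:C%C.
  have := mem_nth 0 (ltn_ord k); rewrite -/rs' mem_rem_uniq // inE => /andP[? ?].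
  by split.
have [s sP] : exists s : 'I_d -> {rmorphism Qadj q -> R[i]},
    forall k (x : Qadj q) (g : {poly rat}),
    val x = (map_poly ratr g).[q] -> s k x = (map_poly ratr g).[rs'`_k].
  suff /choice[s sP] : forall k : 'I_d, exists s : {rmorphism Qadj q -> R[i]},
      forall (x : Qadj q) (g : {poly rat}),
      val x = (map_poly ratr g).[q] -> s x = (map_poly ratr g).[rs'`_k].
    by exists s.
  by move=> k; apply: embedding_exists; rewrite rsE; case: (rs'P k).
exists d, s; split.
  move=> k; rewrite (sP k _ 'X) ?map_polyX ?hornerX //.
  have [krs /eqP kq] := rs'P k.
  apply: hconj => //; exists m; split => //; first by rewrite mdvd.
  by rewrite rsE.
move=> x xint xlt.
have [r rE] := prod_horner_roots_rat (Qadj_rep x) mE urs.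
have NE : ratr r = (val x)%:C%C * \prod_k s k x.
  rewrite -rE (perm_big _ (perm_to_rem qrs)) big_cons qC -Qadj_repP.
  congr (_ * _); rewrite (big_nth 0) big_mkord; apply: eq_bigr => k _.
  by rewrite (sP _ _ _ (Qadj_repP x)).
have rint : r \is a Num.int.
  apply: (@integral_rat_int R[i]); rewrite NE.
  pose s0 : {rmorphism Qadj q -> R[i]} := (real_complex R \o val)%FUN.
  apply: integral_mul; first exact: (algebraic_integer_rmorph s0).
  elim/big_ind : _ => [|u v|k _]; first exact: integral1.
    exact: integral_mul.
  exact: algebraic_integer_rmorph.
have r0 : r = 0.
  apply/eqP; rewrite -[_ == _]negbK; apply/negP => /(norm_intr_ge1 rint).
  apply/negP; rewrite -ltNge -(ltr_rat R).
  move: xlt; rewrite -normc_prod -normc_real -normcM -NE.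
  have -> : (ratr r : R[i]) = (ratr r)%:C%C by rewrite -(fmorph_rat (real_complex R)).
  by rewrite normc_real rmorph1 ratr_norm.
move: NE; rewrite r0 rmorph0 => /esym/eqP; rewrite mulf_eq0 => /orP[|].
  rewrite -[0]/(0%:C)%C (inj_eq (@complexI _)) => /eqP x0.
  by apply: val_inj.
by move=> /prodf_eq0[k _]; rewrite fmorph_eq0 => /eqP.
Qed.

(** Each element is a rational polynomial in [q]; clearing the denominators of its coefficients
    leaves an integer polynomial in [q]. The product of these denominators serves the whole
    family. *)
Lemma common_denominator (I : finType) (c : I -> Qadj q) :
  exists2 D : nat, (0 < D)%N & forall i, algebraic_integer (val (D%:R * c i)).
Proof.
have one_den (x : Qadj q) : exists D : nat, (0 < D)%N /\
    algebraic_integer (val (D%:R * x)).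
  have [g gx] := Qadj_polynomial x.
  have [h [a a0 gE]] := rat_poly_scale g.
  exists `|a|%N; split; first by rewrite absz_gt0.
  have -> : val (`|a|%:R * x) = (sgz a)%:~R * (map_poly intr h).[q].
    rewrite [LHS]rmorphM rmorph_nat /= gx gE map_polyZ hornerZ.
    rewrite -map_poly_comp; set y := (map_poly _ h).[q].
    have -> : (map_poly intr h).[q] = y.
      by congr (_.[_]); apply: eq_map_poly => i /=; rewrite ratr_int.
    rewrite fmorphV /= ratr_int mulrA; congr (_ * _).
    have aR : (a%:~R : R) != 0 by rewrite intr_eq0.
    apply: (mulIf aR); rewrite mulfVK // -intrM -abszEsg.
    by rewrite pmulrn.
  apply: integral_mul; first exact: integral_id.
  apply: integral_horner => //.
  move=> y /(nthP 0)[k _ <-]; rewrite coef_map; exact: integral_id.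
have [D DP] := choice (fun i => one_den (c i)).
exists (\prod_i D i)%N; first by apply: prodn_gt0 => i; case: (DP i).
move=> i; set P := (\prod_(k | k != i) D k)%N.
have -> : val ((\prod_k D k)%N%:R * c i) = P%:R * val ((D i)%:R * c i).
  rewrite (bigD1 i) // natrM mulrAC mulrC.
  by rewrite [LHS](rmorphM (val : {rmorphism Qadj q -> R})) rmorph_nat.
apply: integral_mul; last by case: (DP i).
exact: integral_nat.
Qed.

End Embeddings.

(** * Growth of real polynomials *)

Section PolynomialGrowth.
Variable R : realType.
Implicit Types p : {poly R}.

Lemma nat_above (x : R) : exists n : nat, x <= n%:R.
Proof.
exists (Num.bound `|x|); apply: le_trans (ler_norm x) _.
exact/ltW/archi_boundP.
Qed.

Lemma poly_norm_bound p n : (size p <= n.+1)%N ->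
  exists2 C : R, 0 < C & forall x b : R, `|x| <= b -> 1 <= b -> `|p.[x]| <= C * b ^+ n.
Proof.
move=> sp; exists (1 + \sum_(i < n.+1) `|p`_i|).
  by rewrite ltr_pwDl // sumr_ge0.
move=> x b xb b1; have b0 : 0 <= b by rewrite (le_trans _ b1).
rewrite (horner_coef_wide _ sp) (le_trans (ler_norm_sum _ _ _)) //.
rewrite mulrDl mul1r -[leLHS]add0r lerD ?exprn_ge0 // mulr_suml.
apply: ler_sum => i _; rewrite normrM normrX ler_wpM2l //.
apply: (@le_trans _ _ (b ^+ i)); first by rewrite lerXn2r ?nnegrE.
by rewrite ler_weXn2l // -ltnS.
Qed.

Lemma poly_lower_bound p n : size p = n.+1 -> 0 < lead_coef p ->
  exists c x0 : R, [/\ 0 < c, 1 <= x0 & forall x : R, x0 <= x -> c * x ^+ n <= p.[x]].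
Proof.
move=> sp lp; pose l := lead_coef p.
have pE : p = l *: 'X^n + (p - l *: 'X^n) by rewrite addrC subrK.
have sr : (size (p - l *: 'X^n)%R <= n)%N.
  apply/leq_sizeP => j; rewrite leq_eqVlt => /orP[/eqP <-|nj].
    by rewrite coefB coefZ coefXn eqxx mulr1 /l lead_coefE sp subrr.
  by rewrite coefB coefZ coefXn gtn_eqF // mulr0 subr0 nth_default // sp.
case: n => [|n] in sp pE sr *.
  exists l, 1; split => // x x1; rewrite pE hornerD.
  move: sr; rewrite leqn0 size_poly_eq0 => /eqP ->.
  by rewrite hornerZ hornerXn expr0 mulr1 horner0 addr0.
have [C C0 HC] := poly_norm_bound sr.
(* Past [2 * C / l] the lower terms, at most [C * x ^+ n], use up at most half of
   [l * x ^+ n.+1]. *)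
exists (l / 2), (1 + 2 * C / l); split.
- by rewrite divr_gt0.
- by rewrite lerDl divr_ge0 ?mulr_ge0 // ltW.
move=> x hx.
have x1 : 1 <= x by apply: le_trans hx; rewrite lerDl divr_ge0 ?mulr_ge0 // ltW.
have xn : 0 <= x ^+ n by rewrite exprn_ge0 // (le_trans _ x1).
have := HC x x; rewrite ger0_norm ?(le_trans ler01) // lexx x1 => /(_ isT isT).
have -> : p.[x] = l * x ^+ n.+1 + (p - l *: 'X^(n.+1)).[x].
  by rewrite hornerD hornerN hornerZ hornerXn addrC subrK.
set r := (_ - _).[x] => /ler_normlP[h _].
have lx : 2 * C <= l * x.
  have : 2 * C / l <= x by apply: le_trans hx; rewrite lerDr.
  by rewrite ler_pdivrMr // (mulrC x).
have := ler_wpM2r xn lx; rewrite exprS; move: h.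
have -> : l / 2 * (x * x ^+ n) = l * x * x ^+ n / 2 by field.
have -> : l * (x * x ^+ n) = l * x * x ^+ n by ring.
move: (l * x * x ^+ n) (x ^+ n) => a b; lra.
Qed.

Lemma poly_abs_lower_bound p : (1 < size p)%N ->
  exists c x0 : R, [/\ 0 < c, 1 <= x0 & forall x : R, x0 <= x -> c * x <= `|p.[x]|].
Proof.
case sp : (size p) => [|[|n]] // _.
have lp0 : lead_coef p != 0 by rewrite lead_coef_eq0 -size_poly_eq0 sp.
have key (r : {poly R}) : size r = n.+2 -> 0 < lead_coef r ->
  exists c x0 : R, [/\ 0 < c, 1 <= x0 & forall x : R, x0 <= x -> c * x <= `|r.[x]|].
  move=> sr lr; have [c [x0 [c0 x01 H]]] := poly_lower_bound sr lr.
  exists c, x0; split => // x hx; apply: le_trans (ler_norm _).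
  apply: le_trans (H x hx); rewrite ler_pM2l // exprS ler_peMr //.
    by rewrite (le_trans _ (le_trans x01 hx)).
  by rewrite exprn_ege1 // (le_trans x01).
have [lp|lp] := ltP 0 (lead_coef p); first exact: key.
have [||c [x0 [c0 x01 H]]] := key (- p).
- by rewrite size_polyN.
- by rewrite lead_coefN oppr_gt0 lt_neqAle lp0.
by exists c, x0; split => // x /H; rewrite hornerN normrN.
Qed.

Lemma lead_coef_deriv_gt0 p n : size p = n.+2 -> 0 < lead_coef p ->
  0 < lead_coef p^`().
Proof.
move=> sp; rewrite !lead_coefE size_deriv sp /= coef_deriv => lp.
by rewrite mulrn_wgt0.
Qed.

(** By the mean value theorem the increment is [y - x] times a value of the derivative, to which
    [poly_lower_bound] applies. *)
Lemma poly_increment_lower p n : size p = n.+2 -> 0 < lead_coef p ->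
  exists c x0 : R, [/\ 0 < c, 1 <= x0 &
    forall x y : R, x0 <= x -> x <= y -> c * (y - x) * x ^+ n <= p.[y] - p.[x]].
Proof.
move=> sp lp.
have sd : size p^`() = n.+1 by rewrite size_deriv sp.
have [c [x0 [c0 x01 H]]] := poly_lower_bound sd (lead_coef_deriv_gt0 sp lp).
exists c, x0; split => // x y hx; rewrite le_eqVlt => /orP[/eqP->|xy].
  by rewrite !subrr mulr0 mul0r.
have [t /[!in_itv]/andP[xt ty] ->] := poly_mvt p xy.
rewrite mulrAC ler_wpM2r ?subr_ge0 ?(ltW xy) //.
apply: le_trans (H t _); last exact: le_trans hx (ltW xt).
rewrite ler_pM2l // lerXn2r ?nnegrE ?ltW //.
  by rewrite (lt_le_trans _ (le_trans x01 hx)).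
by rewrite (lt_trans _ xt) // (lt_le_trans _ (le_trans x01 hx)).
Qed.

Lemma poly_increment_upper p n : (size p <= n.+2)%N ->
  exists2 C : R, 0 < C &
    forall x y : R, 1 <= x -> x <= y -> `|p.[y] - p.[x]| <= C * (y - x) * y ^+ n.
Proof.
move=> sp; have sd : (size p^`() <= n.+1)%N by rewrite size_deriv; case: (size p) sp.
have [C C0 H] := poly_norm_bound sd; exists C => // x y x1.
rewrite le_eqVlt => /orP[/eqP->|xy].
  by rewrite !subrr normr0 mulr0 mul0r.
have [t /[!in_itv]/andP[xt ty] ->] := poly_mvt p xy.
rewrite normrM [`|y - x|]gtr0_norm ?subr_gt0 // mulrAC.
rewrite ler_wpM2r ?subr_ge0 ?(ltW xy) // H ?(le_trans x1) ?(ltW xy) //.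
by rewrite ger0_norm ?(ltW ty) // (le_trans _ (ltW xt)) // (le_trans _ x1).
Qed.

(** Monotonicity may fail on [[0, x0]], but there [p] is at most some [B], which [p] exceeds once
    the argument is beyond [B / c'] and [x2]. *)
Lemma poly_eventually_dominates p n : size p = n.+2 -> 0 < lead_coef p ->
  exists2 x1 : R, 1 <= x1 & forall x y : R, 0 <= x -> x <= y -> x1 <= y -> p.[x] <= p.[y].
Proof.
move=> sp lp.
have [c [x0 [c0 x01 H]]] := poly_increment_lower sp lp.
have [B B0 HB] : exists2 B : R, 0 < B & forall x : R, 0 <= x -> x <= x0 -> p.[x] <= B.
  have spl : (size p <= n.+2)%N by rewrite sp.
  have [C C0 HC] := poly_norm_bound spl; exists (C * x0 ^+ n.+1).
    by rewrite mulr_gt0 // exprn_gt0 // (lt_le_trans _ x01).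
  by move=> x x00 xx0; rewrite (le_trans (ler_norm _)) // HC // ger0_norm.
have [c' [x2 [c'0 x21 H']]] := poly_lower_bound sp lp.
exists (x0 + x2 + B / c').
  by have : 0 < B / c' by [rewrite divr_gt0]; lra.
move=> x y x0' xy hy.
have Bc : 0 < B / c' by rewrite divr_gt0.
have [xx0|xx0] := leP x x0; last first.
  rewrite -subr_ge0; apply: le_trans (H x y (ltW xx0) xy).
  rewrite mulr_ge0 ?exprn_ge0 // mulr_ge0 ?subr_ge0 //; exact: ltW.
apply: (le_trans (HB x x0' xx0)); apply: le_trans (H' y _); last by lra.
have y1 : 1 <= y by lra.
have : B / c' <= y by lra.
rewrite ler_pdivrMr // (mulrC y) => /le_trans; apply.
by rewrite ler_pM2l // exprS ler_peMr // ?exprn_ege1 // (le_trans _ y1).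
Qed.

(** Allowing any nonnegative [v], also where [p] is not monotone, makes the bound applicable to an
    index about which nothing is known in advance. *)
Lemma poly_separation p n : size p = n.+2 -> 0 < lead_coef p ->
  exists c x0 : R, [/\ 0 < c, 1 <= x0 &
    forall u v eta : R, x0 <= u -> 0 <= v -> 0 < eta -> eta <= 1 -> eta <= `|v - u| ->
    c * eta * u ^+ n <= `|p.[v] - p.[u]|].
Proof.
move=> sp lp.
have [c [x0 [c0 x01 H]]] := poly_increment_lower sp lp.
have [x1 x11 H1] := poly_eventually_dominates sp lp.
exists (c * (2^-1) ^+ n), (2 * (x0 + x1)); split.
- by rewrite mulr_gt0 // exprn_gt0 // invr_gt0.
- lra.
move=> u v eta hu v0 e0 e1 hvu.
have u0 : 0 < u by lra.
have [uv|vu] := leP u v.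
  rewrite ger0_norm ?subr_ge0 // in hvu.
  apply: le_trans (ler_norm _); apply: le_trans (H u v _ uv); last by lra.
  rewrite ler_wpM2r ?exprn_ge0 ?(ltW u0) //.
  apply: ler_pM => //; first by rewrite mulr_ge0 ?exprn_ge0 // ltW.
    exact: ltW.
  by rewrite ger_pMr // exprn_ile1 //; lra.
rewrite distrC ger0_norm ?subr_ge0 ?(ltW vu) // in hvu.
(* [v] may lie where increments are not controlled. Moving it up to [w] does not decrease the value
   of [p], keeps the distance [eta] to [u], and costs a factor [2^-1 ^+ n]. *)
pose w : R := Num.max v (u / 2).
have wu : w <= u - eta by rewrite ge_max; apply/andP; split; lra.
have uw : u / 2 <= w by rewrite le_max lexx orbT.
have vw : v <= w by rewrite le_max lexx.
have h1 : p.[v] <= p.[w] by apply: H1 => //; lra.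
have h2 : c * (u - w) * w ^+ n <= p.[u] - p.[w] by apply: H; lra.
rewrite distrC; apply: le_trans (ler_norm _).
apply: (@le_trans _ _ (p.[u] - p.[w])); last by lra.
apply: le_trans h2.
rewrite mulrAC -[c * _ * u ^+ n]mulrA -exprMn mulrAC.
apply: ler_pM; rewrite ?mulr_ge0 ?exprn_ge0 //; try lra.
  by rewrite ler_pM2l //; lra.
by apply: lerXn2r; rewrite ?nnegrE; lra.
Qed.

End PolynomialGrowth.

(** * Gaps between polynomial values *)

Section Gaps.
Variable R : realType.
Implicit Types F G p : {poly R}.

(** If [m = m'], the values of [F] at [N] and [N'] would be closer than its increments allow.
    Otherwise the two values of [G] differ by at least the order of [m' ^ e], with [e.+1] the degree
    of [G], while [F] changes only by the order of [N' ^ n.+1] over the window. As [G.[m']] is at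
    least of the order of [N' ^ n.+2] and [e >= n.+2], this bounds [N']. *)
Lemma gap_higher_degree F G n (W : nat) :
  size F = n.+3 -> 0 < lead_coef F -> 0 < lead_coef G -> (size F < size G)%N ->
  exists (eps : R) (K : nat), 0 < eps /\ forall N N' m m' : nat,
    (K <= N)%N -> (N < N')%N -> (N' <= N + W)%N ->
    `|G.[m%:R] - F.[N%:R]| < eps * N%:R ->
    `|G.[m'%:R] - F.[N'%:R]| < eps * N'%:R -> False.
Proof.
move=> sF lF lG; rewrite sF; case sG : (size G) => [|[|e]] //; rewrite !ltnS => ne.
have [cF [xF [cF0 xF1 HF]]] := poly_increment_lower sF lF.
have sF' : (size F <= n.+3)%N by rewrite sF.
have [CF CF0 HCF] := poly_increment_upper sF'.
have [c1 [x1 [c10 x11 H1]]] := poly_lower_bound sF lF.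
have sG' : (size G <= e.+2)%N by rewrite sG.
have [CG CG0 HCG] := poly_norm_bound sG'.
have [cG [xG [cG0 xG1 HG]]] := poly_separation sG lG.
(* The three bounds serve, in turn, to absorb the errors into [y ^+ n.+1], to exclude [m = m'], and
   to keep [G.[m']] above half the lower bound for [F.[N']]. *)
pose eps : R := Num.min 1 (Num.min (cF / 4) (c1 / 2)).
have eps1 : eps <= 1 by rewrite ge_min lexx.
have epsF : eps <= cF / 4 by rewrite /eps !ge_min lexx orbT.
have epsc : eps <= c1 / 2 by rewrite /eps !ge_min lexx !orbT.
have eps0 : 0 < eps by rewrite !lt_min ltr01 /=; apply/andP; split; lra.
pose C2 : R := 2 + CF * W%:R.
have C20 : 0 < C2 by rewrite /C2 ltr_pwDl // mulr_ge0 // ltW.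
pose C3 := C2 / cG.
have C30 : 0 < C3 by rewrite divr_gt0.
pose C4 := CG * C3 / (c1 / 2).
have C40 : 0 < C4 by rewrite !mulr_gt0 ?invr_gt0 ?mulr_gt0 ?invr_gt0.
pose C5 := C3 * C4 ^+ n.+1.
have C50 : 0 < C5 by rewrite mulr_gt0 ?exprn_gt0.
have [K hK] := nat_above (xF + x1 + W%:R + CG * xG ^+ e.+1 / (c1 / 2) + C4 * C5 + 1).
exists eps, K; split => // N N' m m' KN NN' N'W bad bad'.
have t1 : 0 <= CG * xG ^+ e.+1 / (c1 / 2).
  by rewrite divr_ge0 ?mulr_ge0 ?exprn_ge0 //; lra.
have t2 : 0 <= C4 * C5 by rewrite mulr_ge0 // ltW.
have t3 : 0 <= W%:R :> R by [].
have KNR : K%:R <= N%:R :> R by rewrite ler_nat.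
have NN'R : N%:R + 1 <= N'%:R :> R by rewrite natr1 ler_nat.
have N'WR : N'%:R <= N%:R + W%:R :> R by rewrite -natrD ler_nat.
move: (N%:R) (N'%:R) bad bad' KNR NN'R N'WR => x y bad bad' Kx xy yW.
have x1' : 1 <= x by lra.
have y1 : 1 <= y by lra.
have [mm|mm] := eqVneq m m'.
  rewrite -mm in bad'.
  have : `|F.[y] - F.[x]| < eps * x + eps * y.
    have -> : F.[y] - F.[x] = (G.[m%:R] - F.[x]) - (G.[m%:R] - F.[y]) by ring.
    by apply: le_lt_trans (ler_normB _ _) _; rewrite ltrD.
  apply/negP; rewrite -leNgt; apply: le_trans (ler_norm _).
  apply: le_trans (HF x y _ _); [|lra|lra].
  apply: (@le_trans _ _ (cF * x)).
    have xy0 : 0 <= x + y by lra.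
    have := ler_wpM2r xy0 epsF.
    have : cF * (x + y) <= cF * (4 * x) by rewrite ler_pM2l //; lra.
    lra.
  rewrite -mulrA ler_pM2l // exprS mulrCA ler_peMr //; first lra.
  rewrite mulr_ege1 //; first lra.
  by rewrite exprn_ege1.
have ypow k : 1 <= y ^+ k by rewrite exprn_ege1.
have yxpow k : y <= y ^+ k.+1 by rewrite exprS ler_peMr // (le_trans _ y1).
have low : c1 / 2 * y ^+ n.+2 <= G.[m'%:R].
  have hF : c1 * y ^+ n.+2 <= F.[y] by apply: H1; lra.
  have : eps * y <= c1 / 2 * y ^+ n.+2.
    by apply: ler_pM => //; lra.
  move: bad'; rewrite ltr_norml => /andP[+ _]; lra.
have c12 : 0 < c1 / 2 by lra.
have zxG : xG <= m'%:R.
  rewrite leNgt; apply/negP => zlt.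
  have : G.[m'%:R] <= CG * xG ^+ e.+1.
    by apply: le_trans (ler_norm _) _; apply: HCG => //; rewrite ger0_norm // ltW.
  move/(le_trans low); rewrite mulrC -ler_pdivlMr //.
  by have := yxpow n.+1; lra.
have z1 : 1 <= m'%:R :> R by lra.
have sep : `|m%:R - m'%:R| >= 1 :> R.
  by move: mm; rewrite neq_ltn => /orP[]; rewrite -(ler_nat R) -natr1 => ?;
    [rewrite distrC|]; apply: le_trans (ler_norm _); lra.
have := HG m'%:R m%:R 1 zxG (ler0n _ _) ltr01 (lexx _) sep.
rewrite mulr1; move: (m'%:R) z1 low bad' => z z1 low bad' lz.
have up : cG * z ^+ e <= C2 * y ^+ n.+1.
  apply: le_trans lz _.
  have -> : G.[m%:R] - G.[z] = (G.[m%:R] - F.[x]) - (G.[z] - F.[y]) - (F.[y] - F.[x]) by ring.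
  apply: le_trans (ler_normB _ _) _.
  have := ler_normB (G.[m%:R] - F.[x]) (G.[z] - F.[y]).
  have hi : `|F.[y] - F.[x]| <= CF * W%:R * y ^+ n.+1.
    apply: le_trans (HCF x y _ _) _; [lra|lra|].
    rewrite ler_wpM2r //; first by rewrite (le_trans _ (ypow _)).
    by rewrite ler_pM2l //; lra.
  have ex : eps * x <= y ^+ n.+1.
    by apply: le_trans (yxpow n); rewrite (le_trans (ler_wpM2r _ eps1)) //; lra.
  have ey : eps * y <= y ^+ n.+1.
    by apply: le_trans (yxpow n); rewrite (le_trans (ler_wpM2r _ eps1)) //; lra.
  by rewrite /C2 mulrDl; lra.
have up' : z ^+ e <= C3 * y ^+ n.+1.
  by rewrite /C3 mulrAC ler_pdivlMr // mulrC.
(* [y ^+ n.+2] is bounded by a multiple of [z * z ^+ e], and [z ^+ e] by a multiple of [y ^+ n.+1],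
   which leaves [y] at most a multiple of [z]. Then [z ^+ e] is at most [C5 * z ^+ n.+1], which
   bounds [z]. *)
have yz : y <= C4 * z.
  have G1 : G.[z] <= CG * z ^+ e.+1.
    by apply: le_trans (ler_norm _) _; apply: HCG => //; rewrite ger0_norm //; lra.
  have : c1 / 2 * y * y ^+ n.+1 <= CG * C3 * z * y ^+ n.+1.
    rewrite -mulrA -exprS; apply: (le_trans low); apply: (le_trans G1).
    have -> : CG * C3 * z * y ^+ n.+1 = CG * (z * (C3 * y ^+ n.+1)) by ring.
    rewrite ler_pM2l // [z ^+ e.+1]exprS ler_pM2l //; lra.
  rewrite ler_pM2r; last by rewrite (lt_le_trans _ (ypow _)).
  by rewrite mulrC -ler_pdivlMr // /C4 mulrAC.
have zC5 : z <= C5.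
  have : z ^+ n.+1 * z <= C5 * z ^+ n.+1.
    rewrite -exprSr; apply: (@le_trans _ _ (z ^+ e)).
      by rewrite ler_weXn2l.
    apply: (le_trans up'); rewrite /C5 -mulrA -exprMn ler_pM2l //.
    by apply: lerXn2r; rewrite ?nnegrE //; [lra|rewrite mulr_ge0 //; lra].
  by rewrite mulrC ler_pM2r // (lt_le_trans _ (exprn_ege1 _ z1)).
have : y <= C4 * C5 by apply: (le_trans yz); rewrite ler_pM2l.
lra.
Qed.

(** [F.[N]] equals [G] at [al * N + be] up to the order of [N ^ n], whereas an argument at distance
    [eta] from that point changes [G] by at least a multiple of [N ^ n.+1]. *)
Lemma same_degree_localization F G n (al be eta : R) :
  size G = n.+3 -> 0 < lead_coef G -> 0 < al -> 0 < eta ->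
  (size (F - (G \Po (al%:P * 'X + be%:P)))%R <= n.+1)%N ->
  exists (eps : R) (K : nat), 0 < eps /\ forall N m : nat, (K <= N)%N ->
    `|G.[m%:R] - F.[N%:R]| < eps * N%:R ->
    `|m%:R - (al * N%:R + be)| < eta.
Proof.
move=> sG lG al0 eta0 sD.
wlog eta1 : eta eta0 / eta <= 1.
  move=> H; have [|//|eps [K [eps0 HK]]] := H (Num.min eta 1); last 1 first.
  - exists eps, K; split => // N m KN /(HK N m KN) /lt_le_trans; apply.
    by rewrite ge_min lexx.
  - by rewrite lt_min eta0 ltr01.
  - by rewrite ge_min lexx orbT.
have [c [x0 [c0 x01 H]]] := poly_separation sG lG.
have [C C0 HC] := poly_norm_bound sD.
pose c' := c * eta * (al / 2) ^+ n.+1.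
have al2 : 0 < al / 2 by lra.
have c'0 : 0 < c' by rewrite !mulr_gt0 // exprn_gt0.
(* From [K] on, [al * x + be] is at least [al / 2 * x + x0], and [C * x ^+ n] is less than half of
   [c' * x ^+ n.+1]. *)
have [K hK] := nat_above (1 + (2 * `|be| + 2 * x0) / al + 2 * C / c').
exists (c' / 2), K; split; first lra.
move=> N m KN; have : K%:R <= N%:R :> R by rewrite ler_nat.
move: (N%:R) => x Kx bad; rewrite ltNge; apply/negP => far.
have b0 : 0 <= (2 * `|be| + 2 * x0) / al.
  by rewrite divr_ge0 ?(ltW al0) // addr_ge0 ?mulr_ge0 //; lra.
have b1 : 0 < 2 * C / c' by rewrite divr_gt0 // mulr_gt0.
have x1 : 1 <= x by lra.
have ub : al / 2 * x + x0 <= al * x + be.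
  have : (2 * `|be| + 2 * x0) / al <= x by lra.
  rewrite ler_pdivrMr // => h; have := lerNnormlW (lexx `|be|); lra.
set u := al * x + be in far ub.
have u0 : x0 <= u by apply: le_trans ub; rewrite lerDr mulr_ge0 //; lra.
have := H u m%:R eta u0 (ler0n _ _) eta0 eta1 far; apply/negP; rewrite -ltNge.
have xn : 0 < x ^+ n by rewrite exprn_gt0 //; lra.
have hD : `|F.[x] - G.[u]| <= C * x ^+ n.
  have -> : F.[x] - G.[u] = (F - (G \Po (al%:P * 'X + be%:P))).[x].
    by rewrite hornerD hornerN horner_comp !hornerE.
  by apply: HC => //; rewrite ger0_norm; lra.
have -> : G.[m%:R] - G.[u] = (G.[m%:R] - F.[x]) + (F.[x] - G.[u]) by ring.
apply: le_lt_trans (ler_normD _ _) _.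
apply: (@lt_le_trans _ _ (c' * x ^+ n.+1)); last first.
  rewrite /c' -[leLHS]mulrA -exprMn ler_wpM2l //; first by rewrite mulr_ge0 // ltW.
  by apply: lerXn2r; rewrite ?nnegrE ?mulr_ge0 //; lra.
have h1 : C * x ^+ n < c' / 2 * x ^+ n.+1.
  rewrite exprS mulrA ltr_pM2r //.
  have : 2 * C / c' < x by lra.
  by rewrite ltr_pdivrMr //; lra.
have h2 : c' / 2 * x <= c' / 2 * x ^+ n.+1.
  by rewrite ler_pM2l ?divr_gt0 // exprS ler_peMr ?exprn_ege1 //; lra.
lra.
Qed.

Lemma finite_positive_lower_bound (I : finType) (e : I -> R) :
  (forall i, 0 < e i) -> exists2 d : R, 0 < d & forall i, d <= e i.
Proof.
move=> e0; exists (\big[Num.min/1]_i e i); first exact: lt_bigmin.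
by move=> i; apply: bigmin_le_cond.
Qed.

Lemma distance_to_int_gt0 (y : R) : (forall z : int, z%:~R <> y) ->
  exists2 d : R, 0 < d & forall z : int, d <= `|z%:~R - y|.
Proof.
move=> yZ; pose f : int := Num.floor y.
have f1 : f%:~R < y.
  by rewrite lt_neqAle ge_floor andbT; apply/eqP/yZ.
have f2 : y < f%:~R + 1 by rewrite -intrD1 floorD1_gt.
exists (Num.min (y - f%:~R) (f%:~R + 1 - y)).
  by rewrite lt_min; apply/andP; split; lra.
move=> z; have [zf|zf] := leP z f.
  have zfR : z%:~R <= f%:~R :> R by rewrite ler_int.
  rewrite ge_min; apply/orP; left; rewrite distrC.
  by apply: le_trans (ler_norm _); lra.
have zfR : f%:~R + 1 <= z%:~R :> R by rewrite -intrD1 ler_int lezD1.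
rewrite ge_min; apply/orP; right; apply: le_trans (ler_norm _); lra.
Qed.

Section AffineSubstitution.
Variables a b : R.
Local Notation h := (a%:P * 'X + b%:P).

Lemma coef_affine_exp_gt n k : (n < k)%N -> (h ^+ n)`_k = 0.
Proof.
move=> nk; apply: nth_default; apply: leq_trans nk.
apply: leq_trans (size_poly_exp_leq _ _) _.
have : (size h <= 2)%N by rewrite size_MXaddC; case: ifP; rewrite // ltnS size_polyC_leq1.
by case: (size h) => [|[|[|]]] //= _; rewrite ?mul0n ?mul1n.
Qed.

Lemma coef_affine_expS n k : (h ^+ n.+1)`_k.+1 = a * (h ^+ n)`_k + b * (h ^+ n)`_k.+1.
Proof. by rewrite exprS mulrDl coefD -mulrA !coefCM coefXM. Qed.

Lemma coef_affine_exp_lead n : (h ^+ n)`_n = a ^+ n.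
Proof.
elim: n => [|n IH]; first by rewrite !expr0 coef1.
by rewrite coef_affine_expS IH coef_affine_exp_gt // mulr0 addr0 exprS.
Qed.

Lemma coef_affine_exp_sublead n : (h ^+ n.+1)`_n = n.+1%:R * a ^+ n * b.
Proof.
elim: n => [|n IH].
  by rewrite expr1 coefD coefCM coefX mulr0 coefC add0r expr0 !mul1r.
rewrite coef_affine_expS IH coef_affine_exp_lead -[n.+2]addn1 natrD exprS; ring.
Qed.

End AffineSubstitution.

(** The quotient of the leading coefficients determines [al] as a root of order [n.+2]; the next
    coefficient is then linear in [be], which is chosen to cancel it. *)
Lemma affine_match F G n : size F = n.+3 -> size G = n.+3 ->
  0 < lead_coef F -> 0 < lead_coef G ->
  exists al be : R, 0 < al /\
    (size (F - (G \Po (al%:P * 'X + be%:P)))%R <= n.+1)%N.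
Proof.
move=> sF sG lF lG.
have lFG : 0 < lead_coef F / lead_coef G by rewrite divr_gt0.
pose al := (lead_coef F / lead_coef G) `^ (n.+2%:R)^-1.
have al0 : 0 < al by rewrite powR_gt0.
have alE : al ^+ n.+2 = lead_coef F / lead_coef G.
  by rewrite -powR_mulrn ?ltW // -powRrM mulVf // powRr1 // ltW.
have aln : al ^+ n.+1 != 0 by rewrite expf_neq0 // gt_eqF.
have G2 : G`_n.+2 = lead_coef G by rewrite lead_coefE sG.
have F2 : F`_n.+2 = lead_coef F by rewrite lead_coefE sF.
have lG0 : lead_coef G != 0 by rewrite gt_eqF.
pose be := (F`_n.+1 - G`_n.+1 * al ^+ n.+1) / (lead_coef G * n.+2%:R * al ^+ n.+1).
exists al, be; split => //; apply/leq_sizeP => j; rewrite coefB coef_comp_poly sG.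
rewrite leq_eqVlt => /orP[/eqP <-|].
  rewrite big_ord_recr big_ord_recr /= big1 => [|i _]; last first.
    by rewrite coef_affine_exp_gt ?mulr0 // ltnS ltnW.
  rewrite add0r coef_affine_exp_lead coef_affine_exp_sublead G2 /be.
  have n2 : (n.+2%:R : R) != 0 by [].
  move: aln lG0 n2; move: (n.+2%:R) (al ^+ n.+1) => N A A0 L0 N0.
  by field; rewrite A0 L0 N0.
rewrite leq_eqVlt => /orP[/eqP <-|jn].
  rewrite big_ord_recr /= big1 => [|i _]; last by rewrite coef_affine_exp_gt ?mulr0.
  by rewrite add0r coef_affine_exp_lead G2 F2 alE mulrC divfK // subrr.
rewrite nth_default ?sF // big1 ?subr0 // => i _.
by rewrite coef_affine_exp_gt ?mulr0 // (leq_trans (ltn_ord i)).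
Qed.

(* If [G.[m]] is close to [F.[Nk k]] then [m] is close to [al * (A + P * k) + be].
   When [al] is irrational this cannot happen for both [k] and [k']. When
   [al * P] is an integer it cannot happen for large [k] at all, except if
   [al * A + be] is an integer [C]; then [m = al * (P * k) + C], and the two
   values differ by a polynomial in [k] that is not an integer constant. *)
Lemma gap_same_degree F G n (W P K0 : nat) (A : int) (Nk : nat -> nat) (al be : R) :
  size G = n.+3 -> 0 < lead_coef G -> 0 < al ->
  (size (F - (G \Po (al%:P * 'X + be%:P)))%R <= n.+1)%N ->
  integer_valued F -> integer_valued G ->
  (0 < P)%N ->
  (forall k, (K0 <= k)%N -> (0 < Nk k)%N /\ (Nk k)%:R = A%:~R + P%:R * k%:R :> R) ->
  (forall B : rat, al = ratr B -> exists b : int, al * P%:R = b%:~R) ->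
  (forall (C D : int) (B : rat), 0 < B ->
     F \Po ('X + (A%:~R)%:P) <> G \Po ((ratr B)%:P * 'X + (C%:~R)%:P) + (D%:~R)%:P) ->
  exists (eps : R) (K : nat), 0 < eps /\ forall k k' m m' : nat,
    (K <= k)%N -> (k < k')%N -> (k' <= k + W)%N -> (0 < m)%N -> (0 < m')%N ->
    `|G.[m%:R] - F.[(Nk k)%:R]| < eps * (Nk k)%:R ->
    `|G.[m'%:R] - F.[(Nk k')%:R]| < eps * (Nk k')%:R -> False.
Proof.
move=> sG lG al0 sD iF iG P0 hN hal hi.
have P1 : 1 <= P%:R :> R by rewrite ler1n.
have large K' : exists2 K1, (K0 <= K1)%N & forall k, (K1 <= k)%N -> (K' <= Nk k)%N.
  exists (K0 + K' + `|A|)%N; first by rewrite -addnA leq_addr.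
  move=> k hk; have kK0 : (K0 <= k)%N by lia.
  have [_ NE] := hN k kK0.
  rewrite -(ler_nat R) NE -natrM !pmulrn -intrD ler_int.
  have : (k <= P * k)%N by rewrite leq_pmull.
  lia.
have loc eta : 0 < eta -> exists (eps : R) (K : nat), [/\ 0 < eps, (K0 <= K)%N &
    forall k m, (K <= k)%N -> `|G.[m%:R] - F.[(Nk k)%:R]| < eps * (Nk k)%:R ->
    `|m%:R - (al * P%:R * k%:R + (al * A%:~R + be))| < eta].
  move=> eta0.
  have [eps [K [eps0 HK]]] := same_degree_localization sG lG al0 eta0 sD.
  have [K1 K01 HK1] := large K; exists eps, K1; split => // k m kK1 bad.
  have [_ NE] := hN k (leq_trans K01 kK1).
  have := HK (Nk k) m (HK1 k kK1) bad; rewrite NE; congr (`|_| < _); ring.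
have [[B alB]|irr] := pselect (exists B : rat, al = ratr B); last first.
  (* Closeness for both [k] and [k'] puts the integer [m' - m] within less than [d] of
     [al * P * (k' - k)]. For each of the finitely many differences from 1 to [W] this number is
     irrational, hence at positive distance from the integers; [d] is at most all these
     distances. *)
  have dist (w : 'I_W.+1) : (0 < w)%N -> exists2 d : R, 0 < d &
      forall z : int, d <= `|z%:~R - al * P%:R * w%:R|.
    move=> w0; apply: distance_to_int_gt0 => z zE; apply: irr.
    exists (z%:~R / (P * w)%:R).
    rewrite fmorph_div /= ratr_int ratr_nat zE -mulrA -natrM mulfK //.
    by rewrite pnatr_eq0 -lt0n muln_gt0 P0.
  have [e he] : exists e : 'I_W.+1 -> R, forall w, 0 < e w /\
      ((0 < w)%N -> forall z : int, e w <= `|z%:~R - al * P%:R * w%:R|).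
    suff /choice[e he] : forall w : 'I_W.+1, exists d : R, 0 < d /\
      ((0 < w)%N -> forall z : int, d <= `|z%:~R - al * P%:R * w%:R|).
      by exists e.
    move=> w; have [w0|] := posnP w; first by exists 1; split; rewrite // w0.
    by move=> /dist[d d0 hd]; exists d.
  have [d d0 hd] := finite_positive_lower_bound (fun w => (he w).1).
  have [|eps [K [eps0 K0K HK]]] := loc (d / 2); first lra.
  exists eps, K; split => // k k' m m' kK kk' k'W _ _ bad bad'.
  have h1 := HK k m kK bad.
  have h2 := HK k' m' (leq_trans kK (ltnW kk')) bad'.
  have wW : (k' - k < W.+1)%N by lia.
  have w0 : (0 < Ordinal wW)%N by rewrite /= subn_gt0.
  have := (he (Ordinal wW)).2 w0 (m'%:Z - m%:Z).
  move/(le_trans (hd _)); apply/negP; rewrite -ltNge /=.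
  rewrite intrB -!pmulrn natrB ?(ltnW kk') //.
  set c := al * _; set x := al * _ + be in h1 h2.
  have -> : m'%:R - m%:R - c * (k'%:R - k%:R)
     = (m'%:R - (c * k'%:R + x)) - (m%:R - (c * k%:R + x)) by ring.
  by apply: le_lt_trans (ler_normB _ _) _; lra.
have [b bE] := hal B alB.
have mbk (k m : nat) : m%:R - al * P%:R * k%:R = (m%:Z - b * k%:Z)%:~R.
  by rewrite intrB intrM -!pmulrn bE.
have [[C CE]|noC] := pselect (exists C : int, C%:~R = al * A%:~R + be); last first.
  have [|d d0 hd] := @distance_to_int_gt0 (al * A%:~R + be).
    by move=> z zE; apply: noC; exists z.
  have [eps [K [eps0 K0K HK]]] := loc d d0.
  exists eps, K; split => // k k' m m' kK _ _ _ _ bad _.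
  have := HK k m kK bad; rewrite opprD addrA mbk.
  by apply/negP; rewrite -leNgt.
(* Tolerance 1 already forces equality, as [m - al * P * k - C] is an integer. *)
have [eps [K [eps0 K0K HK]]] := loc 1 ltr01.
have mE k m : (K <= k)%N -> `|G.[m%:R] - F.[(Nk k)%:R]| < eps * (Nk k)%:R ->
    m%:R = al * (P%:R * k%:R) + C%:~R.
  move=> kK /(HK k m kK); rewrite -CE opprD addrA mbk -intrB -intr_norm -[1]/(1%:~R) ltr_int.
  move=> h; have : m%:Z - b * k%:Z - C = 0 by lia.
  move/(congr1 (fun z : int => z%:~R : R)); rewrite intrB -mbk mulrA /= => h'; lra.
pose h := F \Po ('X + (A%:~R)%:P) - (G \Po (al%:P * 'X + (C%:~R)%:P)).
have hE k m : (K <= k)%N -> `|G.[m%:R] - F.[(Nk k)%:R]| < eps * (Nk k)%:R ->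
    h.[P%:R * k%:R] = F.[(Nk k)%:R] - G.[m%:R].
  move=> kK bad; rewrite (mE k m kK bad) (hN k (leq_trans K0K kK)).2.
  by rewrite /h hornerD hornerN !horner_comp !hornerE (addrC A%:~R).
have B0 : 0 < B by rewrite -(ltr0q R) -alB.
(* If [h] is constant, a single close pair shows that the constant is a difference of two integer
   values, against [hi]. *)
have [sh|sh] := leqP (size h) 1.
  exists eps, K; split => // k k' m m' kK _ _ m0 _ bad _.
  have [u uE] := iG m m0.
  have [v vE] := iF (Nk k) (hN k (leq_trans K0K kK)).1.
  apply: (hi C (v - u) B B0).
  have hC : h = ((v - u)%:~R)%:P.
    rewrite (size1_polyC sh); congr (_%:P).
    by rewrite intrB -uE -vE -(hE k m kK bad) [in RHS](size1_polyC sh) hornerC.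
  by rewrite -hC -alB /h [RHS]addrC subrK.
(* A nonconstant [h] grows at least linearly in [P * k], and [Nk k] is at most [2 * P * k] for large
   [k], so the values differ by at least [c / 2 * Nk k]. *)
have [c [x0 [c0 x01 Hc]]] := poly_abs_lower_bound sh.
have [K2 hK2] := nat_above (x0 + `|A%:~R|).
exists (Num.min eps (c / 2)), (K + K2)%N; split.
  by rewrite lt_min eps0 divr_gt0.
move=> k k' m m' kK _ _ _ _ bad _.
have kK' : (K <= k)%N by lia.
have kK2 : K2%:R <= k%:R :> R by rewrite ler_nat; lia.
have Nk0 : 0 <= (Nk k)%:R :> R by [].
have bad1 : `|G.[m%:R] - F.[(Nk k)%:R]| < eps * (Nk k)%:R.
  by apply: lt_le_trans bad _; rewrite ler_wpM2r // ge_min lexx.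
have bad2 : `|G.[m%:R] - F.[(Nk k)%:R]| < c / 2 * (Nk k)%:R.
  by apply: lt_le_trans bad _; rewrite ler_wpM2r // ge_min lexx orbT.
have kP : k%:R <= P%:R * k%:R :> R by rewrite ler_peMl.
have A0 : 0 <= `|A%:~R| :> R by [].
have AA : A%:~R <= `|A%:~R| :> R by rewrite ler_norm.
have := Hc (P%:R * k%:R); rewrite (hE k m kK' bad1) distrC => Hx.
have {}Hx : c * (P%:R * k%:R) <= `|G.[m%:R] - F.[(Nk k)%:R]| by apply: Hx; lra.
have : c / 2 * (Nk k)%:R <= c * (P%:R * k%:R).
  rewrite (hN k (leq_trans K0K kK')).2 -mulrA ler_pM2l //; lra.
lra.
Qed.

End Gaps.

(** * Infinitely many isolated values *)

Section InfinitelyManyGaps.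
Variable R : realType.

Lemma rational_multiplier (al : R) : exists Q : nat, (0 < Q)%N /\
  forall B : rat, al = ratr B -> exists b : int, al * Q%:R = b%:~R.
Proof.
have [[B alB]|irr] := pselect (exists B : rat, al = ratr B); last first.
  by exists 1%N; split => // B alB; case: irr; exists B.
exists `|denq B|%N; split => [|_ _]; first by rewrite absz_gt0 denq_neq0.
exists (numq B); have -> : `|denq B|%:R = ratr (denq B)%:~R :> R.
  by rewrite ratr_int pmulrn absz_denq.
by rewrite alB -rmorphM /= -numqE ratr_int.
Qed.

(* Among any [l.+1] consecutive indices [k], each [j] in [S] spoils at most one. *)
Lemma infinitely_many_gaps (l : nat) (f : 'I_l -> {poly R}) (S : {set 'I_l})
    (i : 'I_l) (A : int) (E : nat) :
  (forall j, integer_valued (f j)) -> (forall j, (2 <= (size (f j)).-1)%N) ->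
  (forall j, 0 < lead_coef (f j)) ->
  (forall j, j \in S -> (size (f i) <= size (f j))%N) ->
  (forall j, j \in S -> j != i -> size (f j) = size (f i) ->
     forall (C D : int) (B : rat), 0 < B ->
       f i \Po ('X + (A%:~R)%:P)
         <> f j \Po ((ratr B)%:P * 'X + (C%:~R)%:P) + (D%:~R)%:P) ->
  (0 < E)%N ->
  exists eps : R, [/\ 0 < eps, eps <= 1 & forall N0 : nat, exists n N : nat,
    [/\ (N0 <= n)%N, (N0 <= N)%N, N = absz (E%:Z * n%:Z + A) &
      forall j m, j \in S -> (0 < m)%N -> (j, m) <> (i, N) ->
        eps * N%:R <= `|(f j).[m%:R] - (f i).[N%:R]|]].
Proof.
move=> iv deg lc degmin hi E0.
have [n sFi] : exists n, size (f i) = n.+3.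
  by case: (size (f i)) (deg i) => [|[|[|n]]] // _; exists n.
have [t ht] : exists t : 'I_l -> R * R * nat, forall j, (0 < (t j).2)%N /\
    (size (f j) = size (f i) -> [/\ 0 < (t j).1.1,
      (size (f i - (f j \Po ((t j).1.1%:P * 'X + (t j).1.2%:P)))%R <= n.+1)%N &
      forall B : rat, (t j).1.1 = ratr B ->
        exists b : int, (t j).1.1 * (t j).2%:R = b%:~R]).
  suff /choice[t ht] : forall j, exists t : R * R * nat, (0 < t.2)%N /\
    (size (f j) = size (f i) -> [/\ 0 < t.1.1,
      (size (f i - (f j \Po (t.1.1%:P * 'X + t.1.2%:P)))%R <= n.+1)%N &
      forall B : rat, t.1.1 = ratr B ->
        exists b : int, t.1.1 * t.2%:R = b%:~R]) by exists t.
  move=> j; have [sj|sj] := eqVneq (size (f j)) (size (f i)); last first.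
    by exists (0, 0, 1%N); split => // sj'; rewrite sj' eqxx in sj.
  have sFj : size (f j) = n.+3 by rewrite sj.
  have [al [be [al0 sD]]] := affine_match sFi sFj (lc i) (lc j).
  have [Q [Q0 HQ]] := rational_multiplier al.
  by exists (al, be, Q); split.
(* A common multiple of all multipliers, so that along [N = A + P * k] every rational [al] occurring
   gives an integer [al * P]; the factor [E] in [P] keeps [N] in the progression of the
   hypothesis. *)
pose Q := (\prod_j (t j).2)%N.
have Q0 : (0 < Q)%N by apply: prodn_gt0 => j; case: (ht j).
pose P := (E * Q)%N.
have P0 : (0 < P)%N by rewrite muln_gt0 E0.
have Pmult j : exists c : nat, P = ((t j).2 * c)%N.
  by exists (E * \prod_(k | k != j) (t k).2)%N; rewrite /P /Q (bigD1 j) //= mulnCA.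
pose Nk k := absz (E%:Z * (Q * k)%N%:Z + A).
pose K0 := `|A|.+1.
have NkZ k : (K0 <= k)%N -> (0 < Nk k)%N /\ (Nk k)%:Z = A + (P * k)%N%:Z.
  rewrite /K0 /Nk /P => kK; have : (k <= E * Q * k)%N by rewrite leq_pmull.
  rewrite -mulnA => h; split; lia.
have hN k : (K0 <= k)%N -> (0 < Nk k)%N /\ (Nk k)%:R = A%:~R + P%:R * k%:R :> R.
  move=> /NkZ[? NE]; split => //.
  by rewrite pmulrn NE intrD -pmulrn natrM.
have NkS k k' : (K0 <= k)%N -> (k < k')%N -> (k' <= k + l)%N ->
    (Nk k < Nk k')%N /\ (Nk k' <= Nk k + P * l)%N.
  move=> kK kk' k'l; have [_ e] := NkZ k kK.
  have [_ e'] := NkZ k' (leq_trans kK (ltnW kk')).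
  have h1 : (P * k < P * k')%N by rewrite ltn_pmul2l.
  have h2 : (P * k' <= P * k + P * l)%N by rewrite -mulnDr leq_pmul2l.
  split; lia.
have large K : exists2 K1, (K0 <= K1)%N & forall k, (K1 <= k)%N -> (K <= Nk k)%N.
  exists (K0 + K + `|A|)%N; first by rewrite -addnA leq_addr.
  move=> k hk; have [_ e] := NkZ k (leq_trans (leq_addr _ _) (leq_trans (leq_addr _ _) hk)).
  have : (k <= P * k)%N by rewrite leq_pmull.
  lia.
pose bad eps j k := exists m : nat, [/\ (0 < m)%N, (j, m) <> (i, Nk k) &
  `|(f j).[m%:R] - (f i).[(Nk k)%:R]| < eps * (Nk k)%:R].
have one j : exists eK : R * nat, 0 < eK.1 /\ (j \in S ->
    forall k k', (eK.2 <= k)%N -> (k < k')%N -> (k' <= k + l)%N ->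
    bad eK.1 j k -> bad eK.1 j k' -> False).
  have [jS|jS] := boolP (j \in S); last by exists (1, 0%N); rewrite /=; split.
  (* For [j = i] the affine map is the identity, and localization within 1 gives [m = N], the pair
     excluded in [bad]. *)
  have [->|ji] := eqVneq j i.
    have sD : (size (f i - (f i \Po (1%:P * 'X + 0%:P)))%R <= n.+1)%N.
      by rewrite mul1r addr0 comp_polyXr subrr size_poly0.
    have [eps [K [eps0 HK]]] := same_degree_localization sFi (lc i) ltr01 ltr01 sD.
    have [K1 _ HK1] := large K; exists (eps, K1); split => //= _ k k' kK _ _ + _.
    move=> [m [m0 mN]] /(HK _ _ (HK1 k kK)); rewrite mul1r addr0 => h.
    apply: mN; congr pair; apply/eqP; rewrite -(eqr_nat R) -subr_eq0.
    move: h; rewrite !pmulrn -intrB -intr_norm -[1%R]/(1%:~R : R) ltr_int intr_eq0; lia.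
  have [sj|sj] := eqVneq (size (f j)) (size (f i)).
    have sFj : size (f j) = n.+3 by rewrite sj.
    have [al0 sD hal] := (ht j).2 sj.
    have hal' (B : rat) : (t j).1.1 = ratr B -> exists b : int, (t j).1.1 * P%:R = b%:~R.
      move=> /hal[b bE]; have [c ->] := Pmult j.
      by exists (b * c%:Z); rewrite natrM mulrA bE intrM -pmulrn.
    have [eps [K [eps0 HK]]] := gap_same_degree l sFj (lc j) al0 sD (iv i) (iv j)
      P0 hN hal' (hi j jS ji sj).
    exists (eps, K); split => //= _ k k' kK kk' k'l [m [m0 _ bm]] [m' [m'0 _ bm']].
    exact: (HK k k' m m').
  have sij : (size (f i) < size (f j))%N by rewrite ltn_neqAle eq_sym sj degmin.
  (* A window of [l] steps in [k] is one of [P * l] in [N]. *)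
  have [eps [K [eps0 HK]]] := gap_higher_degree (P * l) sFi (lc i) (lc j) sij.
  have [K1 K01 HK1] := large K.
  exists (eps, K1); split => //= _ k k' kK kk' k'l [m [m0 _ bm]] [m' [m'0 _ bm']].
  have [h1 h2] := NkS k k' (leq_trans K01 kK) kk' k'l.
  exact: (HK (Nk k) (Nk k') m m' (HK1 k kK)).
have [e he] := choice one.
have [d d0 hd] := finite_positive_lower_bound (fun j => (he j).1).
pose eps := Num.min d 1.
exists eps; split; first by rewrite lt_min d0 ltr01.
  by rewrite ge_min lexx orbT.
move=> N0; have [K1 K01 HK1] := large N0.
pose K := (\max_j (e j).2 + K1 + N0)%N.
have monbad j k : bad eps j k -> bad (e j).1 j k.
  move=> [m [m0 mN bm]]; exists m; split => //.
  apply: lt_le_trans bm _; rewrite ler_wpM2r //.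
  by rewrite (le_trans _ (hd j)) // ge_min lexx.
have [k gk] : exists k : 'I_l.+1, forall j, j \in S -> ~ bad eps j (K + k)%N.
  apply: contrapT => nok.
  (* Pigeonhole: [phi] would be an injection from [l.+1] indices into [l]. *)
  have /choice[phi hphi] : forall k : 'I_l.+1, exists j, j \in S /\ bad eps j (K + k)%N.
    move=> k; apply: contrapT => nj; apply: nok; exists k => j jS bj.
    by apply: nj; exists j.
  have : injective phi.
    have lt_case (k k' : 'I_l.+1) : phi k = phi k' -> (k < k')%N -> False.
      move=> pk kk'; have [jS b1] := hphi k; have [_ b2] := hphi k'.
      rewrite -pk in b2.
      apply: ((he (phi k)).2 jS (K + k)%N (K + k')%N); [| | |exact: monbad|exact: monbad].
      - rewrite /K -!addnA (leq_trans _ (leq_addr _ _)) //.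
        exact: (@leq_bigmax _ (fun j => (e j).2)).
      - by rewrite ltn_add2l.
      - by rewrite -addnA leq_add2l (leq_trans _ (leq_addl _ _)) // -ltnS.
    move=> k k' pk; apply/val_inj; case: (ltngtP k k') => // kk'.
      by have := lt_case _ _ pk kk'.
    by have := lt_case _ _ (esym pk) kk'.
  by move/leq_card; rewrite !card_ord ltnn.
exists (Q * (K + k))%N, (Nk (K + k)%N); split => //.
- rewrite (leq_trans _ (leq_pmull _ Q0)) // /K; lia.
- by apply: HK1; rewrite /K; lia.
move=> j m jS m0 mN; rewrite leNgt; apply/negP => lt.
by apply: (gk j jS); exists m.
Qed.

End InfinitelyManyGaps.

(** * Truncated sums *)

Section Estimates.
Variable R : realType.

Lemma bernoulli_ineq (t : R) n : 1 <= t -> 1 + n%:R * (t - 1) <= t ^+ n.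
Proof.
move=> t1; elim: n => [|n IH]; first by rewrite mul0r addr0 expr0.
rewrite exprS -natr1; apply: (@le_trans _ _ (t * (1 + n%:R * (t - 1)))); last first.
  by rewrite ler_wpM2l // (le_trans _ t1).
have : 0 <= n%:R * (t - 1) * (t - 1) by rewrite !mulr_ge0 // subr_ge0.
lra.
Qed.

Lemma exponential_eventually_gt (r D : R) : 1 < r ->
  exists G : nat, forall g, (G <= g)%N -> D < r ^+ g.
Proof.
move=> r1; have [G hG] := nat_above (D / (r - 1)).
have r10 : 0 < r - 1 by lra.
exists G => g Gg; apply: lt_le_trans (bernoulli_ineq g (ltW r1)).
have : D / (r - 1) <= g%:R by apply: le_trans hG _; rewrite ler_nat.
rewrite ler_pdivrMr //; lra.
Qed.

(** The little-o condition with constant [ln t] gives [u n <= t ^+ n] for large [n]; the finitely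
    many other values are absorbed into [C]. *)
Lemma subexponential_bound (u : nat -> R) : (forall n, 0 <= u n) ->
  (fun n : nat => ln (1 + u n) : R) =o_\oo (fun n : nat => n%:R : R) ->
  forall t : R, 1 < t -> exists2 C : R, 0 < C & forall n, u n <= C * t ^+ n.
Proof.
move=> u0 /eqoP uo t t1.
have lt0 : 0 < ln t by rewrite ln_gt0.
have [N _ HN] := uo (ln t) lt0.
exists (1 + \sum_(k < N) u k); first by rewrite ltr_pwDl // sumr_ge0.
move=> n; have tn : 1 <= t ^+ n by rewrite exprn_ege1 // ltW.
have [Nn|nN] := leqP N n.
  apply: (@le_trans _ _ (t ^+ n)); last first.
    by rewrite ler_peMl ?lerDl ?sumr_ge0 // (le_trans _ tn).
  have := HN n Nn; rewrite /= normr_nat => /(le_trans (ler_norm _)).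
  have u1 : 0 < 1 + u n by rewrite ltr_pwDl.
  rewrite mulrC mulr_natl -lnXn; last lra.
  rewrite ler_ln ?posrE ?exprn_gt0 //; lra.
apply: (@le_trans _ _ (1 + \sum_(k < N) u k)); last first.
  by rewrite ler_peMr // addr_ge0 ?sumr_ge0.
rewrite (bigD1 (Ordinal nN)) //= addrCA lerDl addr_ge0 // sumr_ge0 //.
Qed.

Lemma geometric_sum_le (rho : R) L N : 0 <= rho -> rho < 1 ->
  \sum_(L <= n < N) rho ^+ n <= rho ^+ L / (1 - rho).
Proof.
move=> r0 r1; have r10 : 0 < 1 - rho by lra.
rewrite ler_pdivlMr //; have [LN|NL] := leqP L N; last first.
  by rewrite big_geq ?(ltnW NL) // mul0r exprn_ge0.
have -> : (\sum_(L <= n < N) rho ^+ n) * (1 - rho) = rho ^+ L - rho ^+ N.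
  elim: N LN => [|N IH].
    by rewrite leqn0 => /eqP->; rewrite big_geq // mul0r subrr.
  rewrite leq_eqVlt => /orP[/eqP->|]; first by rewrite big_geq // mul0r subrr.
  by rewrite ltnS => LN; rewrite big_nat_recr //= mulrDl IH // exprS; ring.
by rewrite gerBl exprn_ge0.
Qed.

Lemma geometric_series_cvg (u : nat -> R) (C rho : R) L :
  0 <= C -> 0 <= rho -> rho < 1 ->
  (forall n, (L <= n)%N -> `|u n| <= C * rho ^+ n) ->
  cvgn (fun N : nat => \sum_(1 <= n < N) u n).
Proof.
move=> C0 r0 r1 H.
rewrite (is_cvg_series_restrict 1 u) -(is_cvg_series_restrict L u).
pose w n := if (L <= n)%N then u n else 0.
have -> : (fun N => \sum_(L <= n < N) u n) = (fun N => \sum_(L <= n < N) w n).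
  apply/funext => N; apply: eq_big_nat => n /andP[Ln _]; by rewrite /w Ln.
rewrite (is_cvg_series_restrict L w); apply: normed_cvg.
apply: (@series_le_cvg _ _ (geometric C rho)).
- by move=> n; rewrite /= normr_ge0.
- by move=> n; rewrite /= mulr_ge0 ?exprn_ge0.
- move=> n; rewrite /= /w; case: ifP => [/H//|_].
  by rewrite normr0 mulr_ge0 ?exprn_ge0.
- by apply: is_cvg_geometric_series; rewrite ger0_norm.
Qed.

Lemma geometric_tail_bound (u : nat -> R) (C rho x : R) L :
  (0 < L)%N -> 0 <= C -> 0 <= rho -> rho < 1 ->
  (forall n, (L <= n)%N -> `|u n| <= C * rho ^+ n) ->
  (fun N : nat => \sum_(1 <= n < N) u n) @ \oo --> x ->
  `|x - \sum_(1 <= n < L) u n| <= C * (rho ^+ L / (1 - rho)).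
Proof.
move=> L0 C0 r0 r1 H ux; set s := \sum_(1 <= n < L) u n.
have : (fun N : nat => `|\sum_(1 <= n < N) u n - s|) @ \oo --> `|x - s|.
  by apply: cvg_norm; apply: cvgB => //; exact: cvg_cst.
move/cvgr_to_le; apply.
exists L => // N /= LN; rewrite (big_cat_nat L0 LN) /= -/s addrAC subrr add0r.
apply: (le_trans (ler_norm_sum _ _ _)).
apply: (@le_trans _ _ (\sum_(L <= n < N) C * rho ^+ n)).
  by rewrite big_nat [leRHS]big_nat; apply: ler_sum => n /andP[/H].
by rewrite -mulr_sumr ler_wpM2l // geometric_sum_le.
Qed.

(** If a nonnegative [u] vanished infinitely often, every tail infimum would be 0. *)
Lemma limn_einf_neq0 (u : nat -> R) : (forall n, 0 <= u n) ->
  limn_einf (fun n => (u n)%:E) <> 0%E ->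
  exists N, forall n, (N <= n)%N -> u n <> 0.
Proof.
move=> u0 hl; apply: contrapT => H; apply: hl.
rewrite limn_einf_lim; suff -> : einfs (fun n => (u n)%:E) = cst 0%E.
  exact: lim_cst.
apply/funext => n; apply/eqP; rewrite eq_le; apply/andP; split.
  have [k [nk uk]] : exists k, (n <= k)%N /\ u k = 0.
    apply: contrapT => H2; apply: H; exists n => k nk uk.
    by apply: H2; exists k.
  by apply: ereal_inf_lbound; exists k => //=; rewrite uk.
by apply/ereal_infP => _ [k _ <-]; rewrite lee_fin.
Qed.

End Estimates.

(** * Vanishing of truncated sums at a gap *)

Section GapPrinciple.
Variables (R : realType) (q : R) (l : nat).
Variables (S : {set 'I_l}) (c0 : Qadj q) (c : 'I_l -> Qadj q).
Variables (a : 'I_l -> nat -> Qadj q) (F : 'I_l -> nat -> int).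
Import Normc.

Local Notation K := (Qadj q).
Local Notation theta := (Qadj_gen q).
Local Notation vK := (val : {rmorphism K -> R}).

(** This is [q ^ M] times the part of the linear relation with exponents at most [M] and indices
    below [L]. The cutoff makes [M - F j n] nonnegative, so its absolute value is the true exponent
    and only nonnegative powers of [q] occur. *)
Definition truncation (M L : nat) : K :=
  c0 * theta ^+ M + \sum_(j in S) \sum_(1 <= n < L | F j n <= M%:Z)
    c j * a j n * theta ^+ `|M%:Z - F j n|.

Lemma truncation_integral M L : algebraic_integer q ->
  algebraic_integer (val c0) -> (forall j, algebraic_integer (val (c j))) ->
  (forall j n, (1 <= n)%N -> algebraic_integer (val (a j n))) ->
  algebraic_integer (val (truncation M L)).
Proof.
move=> iq i0 ic ia.
have iX n : algebraic_integer (vK (theta ^+ n)).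
  elim: n => [|n IH]; first by rewrite expr0 rmorph1; exact: integral1.
  by rewrite exprS rmorphM; apply: integral_mul; [exact: iq|exact: IH].
rewrite -/(vK _) /truncation rmorphD rmorphM.
apply: integral_add; first by apply: integral_mul; [exact: i0|exact: iX].
have isum (I : Type) (r : seq I) (P : pred I) (G : I -> K) :
    (forall k, P k -> algebraic_integer (vK (G k))) ->
    algebraic_integer (vK (\sum_(k <- r | P k) G k)).
  move=> iG; rewrite rmorph_sum; apply: (big_ind (@algebraic_integer R)) => //.
    exact: mxpoly.integral0.
  by move=> ? ?; exact: integral_add.
apply: (isum) => j _; rewrite big_nat_cond; apply: isum => n /andP[/andP[n0 _] _].
rewrite !rmorphM; apply: integral_mul; last exact: iX.
by apply: integral_mul; [exact: ic|exact: ia].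
Qed.

Lemma ler_normc_sum (I : Type) (r : seq I) (P : pred I) (G : I -> R[i]) :
  normc (\sum_(k <- r | P k) G k) <= \sum_(k <- r | P k) normc (G k).
Proof.
elim/big_rec2 : _ => [|k x y _ xy]; first by rewrite normc0.
by apply: le_trans (le_normcD _ _) _; rewrite lerD2l.
Qed.

Lemma normcX (z : R[i]) n : normc (z ^+ n) = normc z ^+ n.
Proof. by elim: n => [|n IH]; rewrite ?expr0 ?normc1 // !exprS normcM IH. Qed.

Lemma normc_ge0 (z : R[i]) : 0 <= normc z.
Proof. by case: z => x y; rewrite sqrtr_ge0. Qed.

(** Powers of the conjugate of [q] are at most 1 in absolute value whatever their exponent, so the
    bound depends on [L] but not on [M]. *)
Lemma truncation_conjugate_bound (s : {rmorphism K -> R[i]}) (B C t : R) M L :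
  normc (s theta) <= 1 -> 0 <= B -> 0 <= C -> 1 <= t ->
  normc (s c0) <= B -> (forall j, normc (s (c j)) <= B) ->
  (forall j n, normc (s (a j n)) <= C * t ^+ n) ->
  normc (s (truncation M L)) <= (B + B * C * l%:R) * (L%:R + 1) * t ^+ L.
Proof.
move=> st B0 C0 t1 sc0 sc sa.
have sX n : normc (s (theta ^+ n)) <= 1.
  by rewrite rmorphXn normcX exprn_ile1 // normc_ge0.
have tX n : 1 <= t ^+ n by rewrite exprn_ege1.
have BC0 : 0 <= B * C by rewrite mulr_ge0.
rewrite /truncation rmorphD; apply: (le_trans (le_normcD _ _)).
apply: (@le_trans _ _ (B + \sum_(j : 'I_l) L%:R * (B * C * t ^+ L))); last first.
  rewrite sumr_const card_ord -mulr_natr.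
  have h1 : 0 <= L%:R * t ^+ L by rewrite mulr_ge0 // (le_trans _ (tX L)).
  have h2 := mulr_ge0 B0 h1.
  have h3 : B <= B * t ^+ L by rewrite ler_peMr.
  have h4 : 0 <= B * C * l%:R * t ^+ L by rewrite !mulr_ge0 // (le_trans _ (tX L)).
  lra.
apply: lerD.
  rewrite rmorphM normcM -[leRHS]mulr1; apply: ler_pM => //; exact: normc_ge0.
rewrite rmorph_sum; apply: (le_trans (ler_normc_sum _ _ _)).
rewrite big_mkcond; apply: ler_sum => j _.
have r0 : 0 <= L%:R * (B * C * t ^+ L) by rewrite !mulr_ge0 // (le_trans _ (tX L)).
case: ifP => // _; rewrite rmorph_sum; apply: (le_trans (ler_normc_sum _ _ _)).
apply: (@le_trans _ _ (\sum_(0 <= n < L) B * C * t ^+ L)); last first.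
  by rewrite sumr_const_nat subn0 -[leLHS]mulr_natl.
case: L r0 => [|L] r0; first by rewrite !big_geq.
rewrite [leRHS]big_ltn // -[leLHS]add0r lerD ?mulr_ge0 ?(le_trans _ (tX _)) //.
rewrite big_mkcond; rewrite big_nat [leRHS]big_nat; apply: ler_sum => n /andP[_ nL].
case: ifP => [_|_]; last by rewrite mulr_ge0 // (le_trans _ (tX _)).
rewrite !rmorphM !normcM -[leRHS]mulr1.
apply: ler_pM; rewrite ?mulr_ge0 ?normc_ge0 //.
rewrite -mulrA; apply: ler_pM; rewrite ?normc_ge0 //.
apply: (le_trans (sa _ _)); rewrite ler_wpM2l // ler_weXn2l //; exact: ltnW.
Qed.

(** By the relation, the truncation is minus the sum of the omitted terms. Those with [n < L] gain
    [q ^- g] from the gap; those with [n >= L] have exponent at least [M + n] and form a geometric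
    tail of ratio [t / q], where [g <= L] yields the same gain. *)
Lemma truncation_real_bound (x : 'I_l -> R) (B C t : R) (M L g : nat) :
  0 <= B -> 0 <= C -> 1 <= t -> t < q -> (0 < L)%N -> (g <= L)%N ->
  (forall j, `|val (c j)| <= B) ->
  (forall j n, `|val (a j n)| <= C * t ^+ n) ->
  (forall j, j \in S ->
    (fun N : nat => \sum_(1 <= n < N) val (a j n) / q ^ F j n) @ \oo --> x j) ->
  val c0 + \sum_(j in S) val (c j) * x j = 0 ->
  (forall j n, j \in S -> (L <= n)%N -> M%:Z + n%:Z <= F j n) ->
  (forall j n, j \in S -> (1 <= n)%N -> M%:Z < F j n -> M%:Z + g%:Z <= F j n) ->
  `|val (truncation M L)| <=
    (B * C * l%:R) * (L%:R + (1 - t / q)^-1) * t ^+ L / q ^+ g.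
Proof.
move=> B0 C0 t1 tq L0 gL cB aC ux rel big gap.
have q1 : 1 < q := le_lt_trans t1 tq.
have q0 : 0 < q by lra.
have qn0 n : 0 < q ^+ n by rewrite exprn_gt0.
have qz0 (z : int) : 0 < q ^ z by rewrite exprz_gt0.
have qz_ge (z : int) n : n%:Z <= z -> q ^+ n <= q ^ z.
  by move=> nz; rewrite exprnP ler_weXz2l // ltW.
set rho := t / q.
have rho0 : 0 <= rho by rewrite divr_ge0; lra.
have rho1 : rho < 1 by rewrite ltr_pdivrMr // mul1r.
have tX n : 1 <= t ^+ n by rewrite exprn_ege1.
(* The omitted terms of the [j]-th series, scaled by [q ^+ M]: those above the cutoff, then the tail
   from [L] on. *)
pose br j : R := \sum_(1 <= n < L | ~~ (F j n <= M%:Z)) val (a j n) * (q ^+ M / q ^ F j n)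
  + q ^+ M * (x j - \sum_(1 <= n < L) val (a j n) / q ^ F j n).
have E : val (truncation M L) = - \sum_(j in S) val (c j) * br j.
  have -> : val (truncation M L) = val c0 * q ^+ M + \sum_(j in S)
      \sum_(1 <= n < L | F j n <= M%:Z) val (c j) * (val (a j n) * (q ^+ M / q ^ F j n)).
    rewrite -[LHS]/(vK _) /truncation rmorphD rmorphM rmorphXn rmorph_sum.
    congr (_ + _); apply: eq_bigr => j _; rewrite rmorph_sum.
    apply: eq_bigr => n Fn; rewrite !rmorphM rmorphXn /= -mulrA; congr (_ * (_ * _)).
    rewrite [LHS]exprnP; have -> : (`|M%:Z - F j n|%N : int) = M%:Z - F j n by lia.
    by rewrite expfzDr ?gt_eqF // -invr_expz.
  have -> : val c0 = - \sum_(j in S) val (c j) * x j by apply/eqP; rewrite -addr_eq0 rel.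
  rewrite mulNr mulr_suml addrC -sumrB -sumrN; apply: eq_bigr => j _.
  rewrite -mulr_sumr /br.
  set s1 := \sum_(1 <= n < L | F j n <= M%:Z) _.
  set s2 := \sum_(1 <= n < L | ~~ _) _; set T := \sum_(1 <= n < L) _.
  have TE : q ^+ M * T = s1 + s2.
    rewrite mulr_sumr (bigID (fun n => F j n <= M%:Z)) /=.
    by congr (_ + _); apply: eq_bigr => n _; rewrite mulrCA.
  by rewrite [q ^+ M * (x j - T)]mulrBr TE; ring.
have tail j : j \in S -> `|q ^+ M * (x j - \sum_(1 <= n < L) val (a j n) / q ^ F j n)|
    <= C * t ^+ L / q ^+ g * (1 - rho)^-1.
  move=> jS; rewrite normrM (gtr0_norm (qn0 M)).
  have CM : 0 <= C / q ^+ M by rewrite divr_ge0 // ltW.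
  have := @geometric_tail_bound R _ (C / q ^+ M) rho (x j) L L0 CM rho0 rho1 _ (ux j jS).
  move=> H; apply: (@le_trans _ _ (q ^+ M * (C / q ^+ M * (rho ^+ L / (1 - rho))))).
    rewrite ler_pM2l //; apply: H => n Ln.
    rewrite normrM normfV (gtr0_norm (qz0 _)) /rho expr_div_n mulf_div -exprD.
    apply: ler_pM; rewrite ?invr_ge0 ?(ltW (qz0 _)) //.
    by rewrite lef_pV2 ?posrE //; apply: qz_ge; rewrite PoszD big.
  rewrite mulrA (mulrC (q ^+ M)) divfK ?gt_eqF // mulrA.
  rewrite ler_wpM2r ?invr_ge0 ?subr_ge0 ?(ltW rho1) //.
  rewrite -mulrA ler_wpM2l // /rho expr_div_n ler_wpM2l ?(le_trans _ (tX _)) //.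
  by rewrite lef_pV2 ?posrE // ler_weXn2l // ltW.
have mid j : j \in S -> `|\sum_(1 <= n < L | ~~ (F j n <= M%:Z)) val (a j n) * (q ^+ M / q ^ F j n)|
    <= L%:R * (C * t ^+ L / q ^+ g).
  move=> jS; have r0 : 0 <= C * t ^+ L / q ^+ g.
    by rewrite divr_ge0 ?mulr_ge0 ?(le_trans _ (tX _)) // ltW.
  apply: (le_trans (ler_norm_sum _ _ _)).
  apply: (@le_trans _ _ (\sum_(1 <= n < L) C * t ^+ L / q ^+ g)); last first.
    rewrite sumr_const_nat -[leLHS]mulr_natl ler_wpM2r // ler_nat leq_subr //.
  rewrite big_mkcond big_nat [leRHS]big_nat; apply: ler_sum => n /andP[n1 nL].
  case: ifP => // Fn; rewrite normrM -mulrA.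
  have qq : 0 < q ^+ M / q ^ F j n by rewrite divr_gt0.
  rewrite (gtr0_norm qq) mulrA; apply: ler_pM => //; first exact: ltW.
    by apply: (le_trans (aC _ _)); rewrite ler_wpM2l // ler_weXn2l // ltnW.
  rewrite ler_pdivrMr // mulrC ler_pdivlMr // -exprD; apply: qz_ge.
  by rewrite PoszD; apply: gap => //; rewrite ltNge Fn.
rewrite E normrN; apply: (le_trans (ler_norm_sum _ _ _)).
set D := C * t ^+ L / q ^+ g in mid tail.
have D0 : 0 <= D by rewrite divr_ge0 ?mulr_ge0 ?(le_trans _ (tX _)) // ltW.
have rinv : 0 <= (1 - rho)^-1 by rewrite invr_ge0 subr_ge0 ltW.
apply: (@le_trans _ _ (\sum_(j : 'I_l) B * (L%:R * D + D * (1 - rho)^-1))); last first.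
  by rewrite sumr_const card_ord -mulr_natr /D le_eqVlt; apply/orP; left; apply/eqP; ring.
rewrite big_mkcond; apply: ler_sum => j _; case: ifP => jS; last first.
  by rewrite mulr_ge0 // addr_ge0 // mulr_ge0.
rewrite normrM; apply: ler_pM => //.
by apply: (le_trans (ler_normD _ _)); rewrite lerD ?mid ?tail.
Qed.

Lemma finite_upper_bound (I : finType) (e : I -> R) :
  exists2 B : R, 0 < B & forall i, e i <= B.
Proof.
exists (1 + \sum_i `|e i|); first by rewrite ltr_pwDl // sumr_ge0.
move=> i; apply: (le_trans (ler_norm _)); rewrite (bigD1 i) //= addrCA lerDl.
by rewrite addr_ge0 // sumr_ge0.
Qed.

(* The norm of the truncation is at most [D * t ^ (m * g) / q ^ g] for a
   suitable [m]; choosing [t] with [t ^ (2 * m) = q] makes it less than 1. *)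
Lemma truncation_eq0 (d : nat) (s : 'I_d -> {rmorphism K -> R[i]}) (x : 'I_l -> R)
    (C1 Cg : nat) :
  1 < q -> algebraic_integer q -> algebraic_integer (val c0) ->
  (forall j, algebraic_integer (val (c j))) ->
  (forall j n, (1 <= n)%N -> algebraic_integer (val (a j n))) ->
  (forall k, normc (s k theta) <= 1) ->
  (forall y : K, algebraic_integer (val y) ->
      `|val y| * \prod_k normc (s k y) < 1 -> y = 0) ->
  (forall t : R, 1 < t -> exists2 C : R, 0 < C & forall j n,
      `|val (a j n)| <= C * t ^+ n /\ forall k, normc (s k (a j n)) <= C * t ^+ n) ->
  (forall j, j \in S ->
    (fun N : nat => \sum_(1 <= n < N) val (a j n) / q ^ F j n) @ \oo --> x j) ->
  val c0 + \sum_(j in S) val (c j) * x j = 0 -> (0 < C1)%N ->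
  exists N0 : nat, forall N M g : nat,
    (N0 <= N)%N -> (g <= N)%N -> (N <= Cg * g)%N ->
    (forall j n, j \in S -> (C1 * N <= n)%N -> M%:Z + n%:Z <= F j n) ->
    (forall j n, j \in S -> (1 <= n)%N -> M%:Z < F j n -> M%:Z + g%:Z <= F j n) ->
    truncation M (C1 * N) = 0.
Proof.
move=> q1 iq i0 ic ia st van gr ux rel C10.
(* The norm bound contains [t] to the power [2 * L * d.+1], and [L = C1 * N] with [N <= Cg * g], so
   this power is at most [m * g]. *)
pose m := (2 * C1 * d.+1 * Cg).+1.
pose t := q `^ ((2 * m)%:R)^-1.
have q0 : 0 < q := lt_trans ltr01 q1.
have m20 : ((2 * m)%:R : R) != 0 by rewrite pnatr_eq0.
have tq : t ^+ (2 * m) = q.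
  by rewrite -powR_mulrn ?powR_ge0 // -powRrM mulVf // powRr1 // ltW.
have t1 : 1 < t.
  have t0 : 0 <= t by rewrite powR_ge0.
  rewrite ltNge; apply/negP => t1.
  have : t ^+ (2 * m) <= 1 by rewrite exprn_ile1.
  by rewrite tq leNgt q1.
have tltq : t < q by rewrite -tq -[ltLHS]expr1 ltr_eXn2l // mul2n.
have [C C0 HC] := gr t t1.
have [B1 B10 HB1] := finite_upper_bound (fun j => `|val (c j)|).
have [B2 B20 HB2] := finite_upper_bound (fun kj : 'I_d * 'I_l => normc (s kj.1 (c kj.2))).
have [B3 B30 HB3] := finite_upper_bound (fun k : 'I_d => normc (s k c0)).
pose B := B1 + B2 + B3.
have B0 : 0 <= B by rewrite /B; lra.
pose kap := (1 - t / q)^-1.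
have kap0 : 0 < kap by rewrite invr_gt0 subr_gt0 ltr_pdivrMr // mul1r.
(* With this constant Bernoulli's inequality gives [L + 1 <= D3 * t ^+ L], so a factor linear in [L]
   costs only another power of [t]. *)
pose D3 := 1 + (t - 1)^-1.
have D30 : 1 < D3 by rewrite ltrDl invr_gt0 subr_gt0.
have LD3 L : L%:R + 1 <= D3 * t ^+ L.
  apply: (@le_trans _ _ (D3 * (1 + L%:R * (t - 1)))); last first.
    by rewrite ler_pM2l ?bernoulli_ineq ?ltW // (lt_trans _ D30).
  have -> : D3 * (1 + L%:R * (t - 1)) = 1 + L%:R * (t - 1) + (t - 1)^-1 + L%:R.
    by rewrite /D3; field; lra.
  have : 0 <= L%:R * (t - 1) by rewrite mulr_ge0 // subr_ge0 ltW.
  have : 0 < (t - 1)^-1 by rewrite invr_gt0 subr_gt0.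
  lra.
pose D2 := B + B * C * l%:R.
pose D1 := B * C * l%:R.
have D10 : 0 <= D1 by rewrite !mulr_ge0 // ltW.
have D20 : 0 <= D2 by rewrite addr_ge0.
pose D4 := D2 * D3 + D1 * (1 + kap) * D3.
have D1k : 0 <= D1 * (1 + kap) by rewrite mulr_ge0 // addr_ge0 // ltW.
have D40 : 0 <= D4 by rewrite addr_ge0 // mulr_ge0 //; lra.
have r1 : 1 < t ^+ m by rewrite exprn_egt1.
have [G HG] := exponential_eventually_gt (D4 ^+ d.+1) r1.
(* Together with [N <= Cg * g] this threshold forces [g] to be at least [G]. *)
exists (Cg * G).+1 => N M g NN0 gN Ncg big gap.
set L := (C1 * N)%N.
have gG : (G <= g)%N.
  rewrite leqNgt; apply/negP => gG.
  have := leq_trans NN0 Ncg; apply/negP.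
  by rewrite -leqNgt leq_mul2l (ltnW gG) orbT.
have L0 : (0 < L)%N by rewrite muln_gt0 C10 (leq_trans _ NN0).
have NL : (N <= L)%N by rewrite leq_pmull.
have tL0 : 0 < t ^+ L by rewrite exprn_gt0 // (lt_trans _ t1).
have conj k : normc (s k (truncation M L)) <= D4 * t ^+ (2 * L).
  apply: le_trans (@truncation_conjugate_bound (s k) B C t M L (st k) B0 (ltW C0) (ltW t1) _ _ _) _.
  - by apply: (le_trans (HB3 k)); rewrite /B; lra.
  - by move=> j; apply: (le_trans (HB2 (k, j))); rewrite /B; lra.
  - by move=> j n; exact: (HC j n).2.
  rewrite mul2n -addnn exprD mulrA ler_pM2r // -/D2.
  apply: (@le_trans _ _ (D2 * (D3 * t ^+ L))); first by rewrite ler_wpM2l.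
  rewrite mulrA ler_pM2r // /D4 lerDl mulr_ge0 //; lra.
have rb : `|val (truncation M L)| <= D4 * t ^+ (2 * L) / q ^+ g.
  apply: le_trans (@truncation_real_bound x B C t M L g B0 (ltW C0) (ltW t1) tltq L0
    (leq_trans gN NL) _ _ ux rel big gap) _.
  - by move=> j; apply: (le_trans (HB1 j)); rewrite /B; lra.
  - by move=> j n; exact: (HC j n).1.
  rewrite ler_pM2r ?invr_gt0 ?exprn_gt0 // mul2n -addnn exprD mulrA ler_pM2r // -/D1 -/kap.
  apply: (@le_trans _ _ (D1 * (1 + kap) * (D3 * t ^+ L))).
    rewrite -mulrA ler_wpM2l //.
    apply: (@le_trans _ _ ((1 + kap) * (L%:R + 1))); last by rewrite ler_pM2l //; lra.
    have : 0 <= kap * L%:R by rewrite mulr_ge0 // ltW.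
    lra.
  rewrite mulrA ler_pM2r // /D4 lerDr mulr_ge0 //; lra.
apply: van; first exact: truncation_integral.
apply: (@le_lt_trans _ _ (D4 * t ^+ (2 * L) / q ^+ g * (D4 * t ^+ (2 * L)) ^+ d)).
  apply: ler_pM => //; first by apply: prodr_ge0 => k _; exact: normc_ge0.
  rewrite -[X in _ <= _ ^+ X](card_ord d) -prodr_const.
  by apply: ler_prod => k _; rewrite normc_ge0 conj.
have qg0 : 0 < q ^+ g by rewrite exprn_gt0.
rewrite mulrAC ltr_pdivrMr // mul1r -exprS exprMn -exprM.
(* One factor compensates the powers of [t] in the numerator, the other exceeds [D4 ^+ d.+1]. *)
have -> : q ^+ g = t ^+ m ^+ g * t ^+ m ^+ g.
  by rewrite -exprD addnn -mul2n -exprM mulnCA mulnA -{1}tq -exprM.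
have t0 : 0 < t := lt_trans ltr01 t1.
apply: (@le_lt_trans _ _ (D4 ^+ d.+1 * t ^+ m ^+ g)); last first.
  by rewrite ltr_pM2r ?HG // !exprn_gt0.
rewrite ler_wpM2l ?exprn_ge0 // -exprM ler_weXn2l ?(ltW t1) //.
apply: (@leq_trans (2 * C1 * d.+1 * (Cg * g))%N).
  by rewrite /L mulnA mulnAC leq_mul2l Ncg orbT.
by rewrite mulnA leq_mul2r /m leqnSn orbT.
Qed.

(** Raising the cutoff from [M - g] to [M] multiplies each retained term by [theta ^+ g] and admits
    only exponents in between; the gap leaves the single exponent [M], whose power of [theta] is
    1. *)
Lemma truncation_isolated_term (i : 'I_l) (N M g L : nat) :
  i \in S -> (1 <= N < L)%N -> F i N = M -> (0 < g <= M)%N ->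
  (forall j n, j \in S -> (1 <= n)%N -> (j, n) <> (i, N) ->
     F j n + g%:Z <= M%:Z \/ M%:Z + g%:Z <= F j n) ->
  truncation M L = theta ^+ g * truncation (M - g) L + c i * a i N.
Proof.
move=> iS /andP[N1 NL] FiN /andP[g0 gM] gap.
rewrite /truncation mulrDr mulrCA -exprD subnKC // -addrA; congr (_ + _).
have -> : c i * a i N = \sum_(j in S) \sum_(1 <= n < L)
    (if (j == i) && (n == N) then c j * a j n else 0).
  rewrite (bigD1 i) //= [X in _ = _ + X]big1 ?addr0 => [|j /andP[_ ji]]; last first.
    by rewrite big1 // => n _; rewrite (negPf ji).
  rewrite (bigD1_seq N) /= ?iota_uniq ?mem_index_iota ?N1 // !eqxx.
  by rewrite big1 ?addr0 // => n nN; rewrite (negPf nN).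
rewrite mulr_sumr -big_split /=; apply: eq_bigr => j jS.
rewrite mulr_sumr big_mkcond [X in _ = X + _]big_mkcond -big_split.
rewrite big_nat [RHS]big_nat; apply: eq_bigr => n /andP[n1 _] /=.
have [/andP[/eqP-> /eqP->]|jnN] := boolP ((j == i) && (n == N)).
  rewrite FiN lexx subrr expr0 mulr1 ifF ?add0r //; lia.
rewrite addr0; have [|h|h] := gap j n jS n1.
- by move=> [ji nN]; rewrite ji nN !eqxx in jnN.
- have -> : F j n <= M%:Z by lia.
  have -> : F j n <= (M - g)%N%:Z by lia.
  rewrite mulrCA -exprD; congr (_ * _ ^+ _); lia.
- have -> : (F j n <= M%:Z) = false by lia.
  by have -> : (F j n <= (M - g)%N%:Z) = false by lia.
Qed.

End GapPrinciple.

(** * Comparison of exponents and extraction of an isolated term *)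

Section PolynomialComparison.
Variable R : realType.

Lemma poly_eventually_ge_id (p : {poly R}) n : size p = n.+3 -> 0 < lead_coef p ->
  exists K : nat, forall k : nat, (K <= k)%N -> k%:R <= p.[k%:R].
Proof.
move=> sp lp; have [c [x0 [c0 x01 H]]] := poly_lower_bound sp lp.
have [K hK] := nat_above (x0 + c^-1); exists K => k Kk.
have kR : K%:R <= k%:R :> R by rewrite ler_nat.
have ci : 0 < c^-1 by rewrite invr_gt0.
have k1 : 1 <= k%:R :> R by lra.
apply: le_trans (H k%:R _); last by lra.
have ck : 1 <= c * k%:R by rewrite mulrC -ler_pdivrMr // mul1r; lra.
rewrite exprS mulrA; apply: le_trans (_ : 1 * k%:R ^+ n.+1 <= _).
  by rewrite mul1r exprS ler_peMr ?exprn_ege1.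
by rewrite ler_pM2r // exprn_gt0 //; lra.
Qed.

(** Supplies a truncation length proportional to [N]: beyond it all exponents exceed [f_i(N)] by at
    least their index. Half of the lower bound for [r.[k]] covers [p.[N]], the other half covers
    [k]. *)
Lemma poly_linear_reindex_bound (p r : {poly R}) n :
  size p = n.+3 -> (size p <= size r)%N -> 0 < lead_coef r ->
  exists C N1 : nat, forall N k : nat, (N1 <= N)%N -> (C * N <= k)%N ->
    p.[N%:R] + k%:R <= r.[k%:R].
Proof.
move=> sp; rewrite sp => spr lr.
have [e sr] : exists e, size r = (n.+2 + e).+1.
  by exists (size r - n.+3)%N; lia.
have sp' : (size p <= n.+3)%N by rewrite sp.
have [Cp Cp0 HCp] := poly_norm_bound sp'.
have [c [x0 [c0 x01 H]]] := poly_lower_bound sr lr.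
have [C hC] := nat_above (2 * Cp / c).
have [N1 hN1] := nat_above (x0 + 2 / c).
exists C.+1, N1 => N k NN1 CNk.
have c2 : 0 < 2 / c by rewrite divr_gt0.
have NR : N1%:R <= N%:R :> R by rewrite ler_nat.
have CNR : (C%:R + 1) * N%:R <= k%:R :> R by rewrite natr1 -natrM ler_nat.
have N1R : 1 <= N%:R :> R by lra.
have C0R : 0 <= C%:R :> R by [].
move: (N%:R) (k%:R) (C%:R) hC NR CNR N1R C0R => x y C' hC NR CNR x1 C'0.
have xy : x <= y by have := mulr_ge0 C'0 (le_trans ler01 x1); lra.
have y1 : 1 <= y by lra.
apply: le_trans (H y _); last by lra.
have yE : y ^+ n.+2 <= y ^+ (n.+2 + e) by rewrite ler_weXn2l // leq_addr.
have : c * y ^+ n.+2 <= c * y ^+ (n.+2 + e) by rewrite ler_pM2l.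
apply: le_trans.
have half1 : y <= c / 2 * y ^+ n.+2.
  have cy : 1 <= c / 2 * y.
    have : 2 / c <= y by lra.
    by rewrite ler_pdivrMr //; lra.
  rewrite exprS mulrA; apply: le_trans (_ : 1 * y ^+ n.+1 <= _).
    by rewrite mul1r exprS ler_peMr ?exprn_ege1 //; lra.
  by rewrite ler_pM2r // exprn_gt0 //; lra.
have half2 : p.[x] <= c / 2 * y ^+ n.+2.
  apply: (le_trans (ler_norm _)); apply: (@le_trans _ _ (Cp * x ^+ n.+2)).
    by apply: HCp => //; rewrite ger0_norm //; lra.
  have C1y : (C' + 1) * x ^+ n.+2 <= y ^+ n.+2.
    apply: (@le_trans _ _ (((C' + 1) * x) ^+ n.+2)).
      rewrite exprMn ler_pM2r ?exprn_gt0 //; last lra.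
      by rewrite exprS ler_peMr ?exprn_ege1 //; lra.
    by apply: lerXn2r; rewrite ?nnegrE ?mulr_ge0 //; lra.
  apply: (@le_trans _ _ (c / 2 * ((C' + 1) * x ^+ n.+2))); last first.
    by rewrite ler_pM2l // divr_gt0.
  rewrite [leRHS]mulrA ler_pM2r ?exprn_gt0 //; last lra.
  by move: hC; rewrite ler_pdivrMr //; lra.
lra.
Qed.

End PolynomialComparison.

Lemma sum_option (V : nmodType) (I : finType) (G : option I -> V) :
  \sum_k G k = G None + \sum_j G (Some j).
Proof.
rewrite (bigD1 None) //=; congr (_ + _).
rewrite (reindex_omap Some id) => [|[]//] /=.
by apply: eq_bigl => j; rewrite eqxx.
Qed.

Lemma subexponential_bound_family (R : realType) (I : finType) (u : I -> nat -> R) :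
  (forall i n, 0 <= u i n) ->
  (forall i, (fun n : nat => ln (1 + u i n) : R) =o_\oo (fun n : nat => n%:R : R)) ->
  forall t : R, 1 < t -> exists2 C : R, 0 < C & forall i n, u i n <= C * t ^+ n.
Proof.
move=> u0 uo t t1.
have /choice[C HC] : forall i, exists C : R, 0 < C /\ forall n, u i n <= C * t ^+ n.
  by move=> i; have [C C0 HC] := subexponential_bound (u0 i) (uo i) t1; exists C.
have [B B0 HB] := finite_upper_bound C.
exists B => // i n; apply: (le_trans ((HC i).2 n)).
by rewrite ler_wpM2r // exprn_ge0 //; lra.
Qed.

Lemma pisot_or_salem_conjugates (R : realType) (q : R) : pisot q \/ salem q ->
  [/\ algebraic_integer q, 1 < q & forall z : R[i],
      galois_conjugate q z -> z <> q%:C%C -> Normc.normc z <= 1].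
Proof.
by case=> [[iq q1 H]|[iq q1 H _]]; split => // z zq zneq; exact/ltW/H.
Qed.

(** Both [M] and [M - g] are admissible cutoffs: above [M - g] the next exponent is [M] itself,
    exactly [g] further. The two vanishing truncations differ by the isolated term, up to a power of
    [q]. *)
Lemma isolated_term_eq0 (R : realType) (q : R) (l : nat) (S : {set 'I_l})
    (c0 : Qadj q) (c : 'I_l -> Qadj q) (a : 'I_l -> nat -> Qadj q)
    (F : 'I_l -> nat -> int) (i : 'I_l) (N M g L : nat) :
  i \in S -> (1 <= N < L)%N -> F i N = M -> (0 < g <= M)%N ->
  (forall j n, j \in S -> (1 <= n)%N -> (j, n) <> (i, N) ->
     g%:Z <= `|F j n - M%:Z|) ->
  (forall j n, j \in S -> (L <= n)%N -> M%:Z + n%:Z <= F j n) ->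
  (forall M' : nat,
    (forall j n, j \in S -> (L <= n)%N -> M'%:Z + n%:Z <= F j n) ->
    (forall j n, j \in S -> (1 <= n)%N -> M'%:Z < F j n -> M'%:Z + g%:Z <= F j n) ->
    truncation S c0 c a F M' L = 0) ->
  c i * a i N = 0.
Proof.
move=> iS NL ME gM gap big tr0.
have gapZ j m : j \in S -> (1 <= m)%N -> (j, m) <> (i, N) ->
    F j m + g%:Z <= M%:Z \/ M%:Z + g%:Z <= F j m.
  by move=> jS m1 jm; have := gap j m jS m1 jm; clear; lia.
have h1 : truncation S c0 c a F M L = 0.
  apply: tr0 => // j m jS m1 MF.
  have [[ji mN]|jm] := pselect ((j, m) = (i, N)).
    by rewrite ji mN ME ltxx in MF.
  by have := gapZ j m jS m1 jm; move: MF; clear; lia.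
have h2 : truncation S c0 c a F (M - g) L = 0.
  apply: tr0 => // [j m jS Lm|j m jS m1 MF].
    by have := big j m jS Lm; move: gM; clear; lia.
  have [[-> ->]|jm] := pselect ((j, m) = (i, N)).
    by rewrite ME; move: gM; clear; lia.
  by have := gapZ j m jS m1 jm; move: gM MF; clear; lia.
by have := truncation_isolated_term c0 c a iS NL ME gM gapZ; rewrite h1 h2 mulr0 add0r.
Qed.

Lemma leq_of_sum5 (a b c d e n : nat) : ((a + b + c + d + e).+1 <= n)%N ->
  [/\ (a <= n)%N, (b <= n)%N, (c <= n)%N, (d <= n)%N & (e <= n)%N].
Proof. by move=> h; split; lia. Qed.

(** * Linear independence of 1 and the series values *)

Unset Implicit Arguments.

Theorem theorem1 (R : realType) (q : R) (hq : pisot q \/ salem q)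
    (l : nat) (hl : (1 <= l)%N)
    (f : 'I_l -> {poly R})
    (hf_int : forall j, integer_valued (f j))
    (hf_deg : forall j, (2 <= (size (f j)).-1)%N)
    (hf_lead : forall j, 0 < lead_coef (f j))
    (a : 'I_l -> nat -> Qadj q)
    (ha_int : forall j n, (1 <= n)%N -> algebraic_integer (val (a j n)))
    (ha_growth : forall (sigma : {rmorphism Qadj q -> R[i]}) (j : 'I_l),
        (fun n : nat => ln (1 + Normc.normc (sigma (a j n))) : R)
          =o_\oo (fun n : nat => n%:R : R))
    (hS : forall S : {set 'I_l}, S != finset.set0 ->
        exists i : 'I_l, i \in S /\ exists A : int,
          (forall j : 'I_l, j \in S :\ i ->
             forall (C D : int) (B : rat), 0 < B ->
               f i \Po ('X + (A%:~R)%:P)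
                 <> f j \Po ((ratr B)%:P * 'X + (C%:~R)%:P) + (D%:~R)%:P)
          /\
          (exists E : nat, (0 < E)%N /\
             (* only the n with E * n + A >= 1, i.e. all large n, matter *)
             limn_einf (fun n : nat =>
               (`|val (a i (absz (E%:Z * n%:Z + A)))|)%:E) <> 0%E)) :
  linearly_independent_over (val : {rmorphism Qadj q -> R})
    (fun k : option 'I_l =>
       if k is Some j
       then limn (fun N : nat =>
              \sum_(1 <= n < N) val (a j n) / q `^ (f j).[n%:R])
       else 1).
Proof.
have [iq q1 hconj] := pisot_or_salem_conjugates hq.
have q0 : 0 < q := lt_trans ltr01 q1.
have [d [s [s1 van]]] := small_algebraic_integer_eq0 iq hconj.
have gr (t : R) : 1 < t -> exists2 C : R, 0 < C & forall j n,
    `|val (a j n)| <= C * t ^+ n /\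
    forall k, Normc.normc (s k (a j n)) <= C * t ^+ n.
  move=> t1.
  pose s0 : {rmorphism Qadj q -> R[i]} := (real_complex R \o val)%FUN.
  (* The real inclusion joins the other embeddings as index [None], so that one constant serves all
     absolute values. *)
  pose sig (k : option 'I_d) : {rmorphism Qadj q -> R[i]} :=
    if k is Some k' then s k' else s0.
  have [|k|C C0 HC] := @subexponential_bound_family R (option 'I_d * 'I_l)%type
    (fun kj n => Normc.normc (sig kj.1 (a kj.2 n))) _ _ t t1.
  - by move=> ? ?; exact: normc_ge0.
  - exact: ha_growth.
  exists C => // j n; split => [|k]; last exact: (HC (Some k, j) n).
  by rewrite -normc_real; exact: (HC (None, j) n).
(* Integer exponents replace the real ones; at [n = 0], which the series skip, [F] is
   unconstrained. *)
have [F FE] : exists F : 'I_l -> nat -> int, forall j n, (0 < n)%N ->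
    (f j).[n%:R] = (F j n)%:~R.
  have /choice[F FE] : forall jn : 'I_l * nat, exists z : int, (0 < jn.2)%N ->
      (f jn.1).[jn.2%:R] = z%:~R.
    move=> [j [|n]] /=; first by exists 0.
    by have [z zE] := hf_int j n.+1 isT; exists z.
  by exists (fun j n => F (j, n)) => j n n0; exact: (FE (j, n)).
have sz j : exists n, size (f j) = n.+3.
  by case: (size (f j)) (hf_deg j) => [|[|[|n]]] // _; exists n.
have Fid j : exists K : nat, forall n, (0 < n)%N -> (K <= n)%N -> n%:Z <= F j n.
  have [n sn] := sz j; have [K HK] := poly_eventually_ge_id sn (hf_lead j).
  exists K => k k0 Kk; rewrite -(ler_int R) -FE // -pmulrn; exact: HK.
pose u j n : R := val (a j n) / q ^ F j n.
pose x j := limn (fun N : nat => \sum_(1 <= n < N) u j n).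
have xE j : limn (fun N : nat => \sum_(1 <= n < N) val (a j n) / q `^ (f j).[n%:R]) = x j.
  rewrite /x; congr (limn _); apply/funext => N; apply: eq_big_nat => n /andP[n1 _].
  by rewrite /u FE // powR_intmul // ltW.
have ux j : (fun N : nat => \sum_(1 <= n < N) u j n) @ \oo --> x j.
  (* Any growth rate strictly between 1 and [q] gives a convergent geometric majorant. *)
  have t1 : 1 < (1 + q) / 2 by lra.
  have [C C0 HC] := gr _ t1; have [K HK] := Fid j.
  apply: (@geometric_series_cvg _ _ C ((1 + q) / 2 / q) K.+1).
  - exact: ltW.
  - by rewrite !divr_ge0 //; lra.
  - by rewrite ltr_pdivrMr //; lra.
  move=> n Kn; have n0 : (0 < n)%N by apply: leq_trans Kn.
  rewrite /u normrM normfV (gtr0_norm (exprz_gt0 _ q0)) expr_div_n mulrA.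
  apply: ler_pM; rewrite ?invr_ge0 ?(ltW (exprz_gt0 _ q0)) //.
    exact: (HC j n).1.
  rewrite lef_pV2 ?posrE ?exprn_gt0 ?exprz_gt0 // exprnP ler_weXz2l ?(ltW q1) //.
  by apply: HK => //; exact: ltnW.
move=> c; rewrite sum_option /= mulr1 => rel.
have {}rel : val (c None) + \sum_j val (c (Some j)) * x j = 0.
  by rewrite -[RHS]rel; congr (_ + _); apply: eq_bigr => j _; rewrite xE.
pose S : {set 'I_l} := [set j | c (Some j) != 0]%SET.
suff S0 : S = finset.set0.
  have cS j : c (Some j) = 0.
    apply/eqP; apply: contrapT => /negP cj.
    by have := finset.in_set0 j; rewrite -S0 finset.in_set cj.
  case=> [j|]; first exact: cS.
  apply: val_inj; rewrite rmorph0 -[RHS]rel big1 ?addr0 // => j _.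
  by rewrite cS rmorph0 mul0r.
apply/eqP; apply: contrapT => /negP S0.
have [D D0 HD] := common_denominator iq c.
pose c' k := D%:R * c k.
have rel' : val (c' None) + \sum_(j in S) val (c' (Some j)) * x j = 0.
  have c'E k : val (c' k) = D%:R * val (c k).
    by rewrite [LHS](rmorphM (val : {rmorphism Qadj q -> R})) rmorph_nat.
  rewrite -[RHS](mulr0 D%:R) -[X in _ = _ * X]rel mulrDr c'E; congr (_ + _).
  rewrite mulr_sumr [LHS]big_mkcond; apply: eq_bigr => j _.
  rewrite finset.in_set c'E -mulrA; case: eqP => [->|//].
  by rewrite (rmorph0 (val : {rmorphism Qadj q -> R})) mul0r mulr0.
have [j0 j0S] := set0Pn _ S0.
case: (arg_minnP (fun j => size (f j)) j0S) => j1 j1S minj1.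
have {}j1S : j1 \in S := j1S.
(* Condition (i) is thus available only among the members of [S] of least degree, whence the premise
   on sizes in [hi] below. *)
pose T : {set 'I_l} := [set j in S | size (f j) == size (f j1)]%SET.
have T0 : T != finset.set0 by apply/set0Pn; exists j1; rewrite inE j1S eqxx.
have [i [iT [A [hA [E [E0 hE]]]]]] := hS T T0.
have [iS /eqP siz] : i \in S /\ size (f i) == size (f j1).
  by move: iT; rewrite inE => /andP.
have degmin j : j \in S -> (size (f i) <= size (f j))%N.
  by rewrite siz; exact: minj1.
have hi j : j \in S -> j != i -> size (f j) = size (f i) ->
    forall (C D : int) (B : rat), 0 < B ->
       f i \Po ('X + (A%:~R)%:P)
         <> f j \Po ((ratr B)%:P * 'X + (C%:~R)%:P) + (D%:~R)%:P.
  by move=> jS ji sj; apply: hA; rewrite !inE ji sj siz eqxx andbT; move: jS; rewrite inE.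
have [eps [eps0 eps1 gaps]] := infinitely_many_gaps hf_int hf_deg hf_lead degmin hi E0.
have [N1 aN1] := limn_einf_neq0 (fun n => normr_ge0 _) hE.
(* [1 < C1] places the index [N] itself below the truncation length [C1 * N]. *)
have [C1 C10 HC1] : exists2 C1 : nat, (1 < C1)%N & exists N2 : nat,
    forall j N k, j \in S -> (N2 <= N)%N -> (C1 * N <= k)%N ->
    (f i).[N%:R] + k%:R <= (f j).[k%:R].
  have [n si] := sz i.
  have /choice[CN HCN] : forall j, exists CN : nat * nat, j \in S ->
      forall N k, (CN.2 <= N)%N -> (CN.1 * N <= k)%N ->
      (f i).[N%:R] + k%:R <= (f j).[k%:R].
    move=> j; have [jS|_] := boolP (j \in S); last by exists (0%N, 0%N).
    have [C [N2 H]] := poly_linear_reindex_bound si (degmin j jS) (hf_lead j).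
    by exists (C, N2).
  exists (2 + \max_j (CN j).1)%N; first by rewrite leq_addr.
  exists (\max_j (CN j).2)%N => j N k jS NN Nk; apply: (HCN j jS).
    by apply: leq_trans NN; exact: (@leq_bigmax _ (fun j => (CN j).2)).
  apply: leq_trans Nk; rewrite leq_mul2r; apply/orP; right.
  apply: leq_trans (leq_addl _ _).
  exact: (@leq_bigmax _ (fun j => (CN j).1)).
have [N2 {}HC1] := HC1.
(* For [g] the integer part of [eps * N], once positive, [eps * N < g + 1 <= 2 * g], so
   [N <= Cg * g]. *)
have [Cg hCg] := nat_above (2 / eps).
have [N3 tr0] := @truncation_eq0 R q l S (c' None) (fun j => c' (Some j)) a F d s x
  C1 Cg q1 iq (HD None) (fun j => HD (Some j)) ha_int s1 van gr (fun j _ => ux j) rel' (ltnW C10).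
have [Ki HKi] := Fid i.
have [N4 hN4] := nat_above eps^-1.
(* One threshold makes [n] large enough for [aN1] and [N] large enough for the remaining
   estimates. *)
have [n [N [nN0 NN0 NE gap]]] := gaps (N1 + N2 + N3 + N4 + Ki).+1.
have [_ NN2 NN3 NN4 NKi] := leq_of_sum5 NN0.
have [nN1 _ _ _ _] := leq_of_sum5 nN0.
have N0 : (0 < N)%N by apply: leq_trans NN0.
have FiN : N%:Z <= F i N by apply: HKi.
have [M ME] : exists M : nat, F i N = M%:Z.
  by exists `|F i N|%N; rewrite gez0_abs // (le_trans _ FiN).
pose g := Num.truncn (eps * N%:R).
have epsN0 : 0 <= eps * N%:R by rewrite mulr_ge0 // ltW.
have /andP[gle glt] := truncn_itv epsN0; rewrite -/g in gle glt.
have NR : N4%:R <= N%:R :> R by rewrite ler_nat.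
have g0 : (0 < g)%N.
  rewrite lt0n; apply/eqP => g0; move: glt; rewrite g0; apply/negP; rewrite -leNgt.
  by rewrite mulrC -ler_pdivrMr // mul1r; apply: le_trans NR.
have gN : (g <= N)%N.
  by rewrite -(ler_nat R); apply: (le_trans gle); rewrite ler_piMl.
have NCg : (N <= Cg * g)%N.
  rewrite -(ler_nat R) natrM; apply: (@le_trans _ _ (2 / eps * g%:R)); last first.
    by rewrite ler_wpM2r.
  rewrite mulrAC ler_pdivlMr // mulrC; apply: (le_trans (ltW glt)).
  by rewrite -natrM ler_nat mul2n -addnn -addn1 leq_add2l.
have gM : (0 < g <= M)%N by rewrite g0 (leq_trans gN) // -lez_nat -ME.
have NL : (1 <= N < C1 * N)%N by rewrite N0 ltn_Pmull.
have /eqP : c' (Some i) * a i N = 0.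
  apply: (@isolated_term_eq0 R q l S (c' None) (fun j => c' (Some j)) a F
    i N M g (C1 * N)%N iS NL ME gM).
  - move=> j m jS m1 jm; have := gap j m jS m1 jm; rewrite !FE // ME => /(le_trans gle).
    by rewrite pmulrn -intrB -intr_norm ler_int.
  - move=> j k jS Ck.
    have k0 : (0 < k)%N by apply: leq_trans Ck; rewrite muln_gt0 N0 ltnW.
    by rewrite -(ler_int R) intrD -ME -!FE // -pmulrn; apply: HC1.
  - by move=> M'; exact: tr0.
(* All three factors are nonzero: [D] is positive, [i] lies in [S], and [a i N] does not vanish
   because [n >= N1]. *)
rewrite mulf_eq0 => /orP[|/eqP a0].
  rewrite mulf_eq0 => /orP[|]; last by move: iS; rewrite finset.in_set => /negPf->.
  rewrite -(fmorph_eq0 (val : {rmorphism Qadj q -> R})) rmorph_nat pnatr_eq0.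
  by rewrite gtn_eqF.
by have := aN1 n nN1; rewrite -NE a0 rmorph0 normr0; apply.
Qed.
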